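(* Let $A\subset\mathbb R^p$ be a compact self-similar fractal satisfying the open set condition, with $\dim_H A=d<s$. Let $\mathfrak N\subset\mathbb N$ be an infinite set of indices and let $\{\omega_N : N\in\mathfrak N\}$ be a sequence of configurations, $\omega_N=\{\boldsymbol x_1^{(N)},\dots,\boldsymbol x_N^{(N)}\}\subset A$ with $\#\omega_N=N$, for which $$\lim_{\mathfrak N\ni N\to\infty}\frac{E_s(\omega_N)}{N^{1+s/d}}=\underline{g}_{s,d}(A).$$ Then the corresponding sequence of empirical measures $$\nu_N:=\frac1N\sum_{i=1}^N\delta_{\boldsymbol x_i^{(N)}}$$ converges weak$^*$ to the normalized Hausdorff measure on $A$: $$\nu_N\stackrel{*}{\longrightarrow}h_d(\cdot):=\frac{\mathcal H_d(\cdot\cap A)}{\mathcal H_d(A)},\qquad \mathfrak N\ni N\to\infty.$$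
   Context: A similitude of $\mathbb R^p$ is a map $\psi(\boldsymbol x)=rO(\boldsymbol x)+\boldsymbol z$ with $O$ an orthogonal $p\times p$ matrix, $\boldsymbol z\in\mathbb R^p$, and contraction ratio $0<r<1$. A nonempty compact set $A\subset\mathbb R^p$ is a self-similar fractal with similitudes $\psi_1,\dots,\psi_M$ ($M\ge2$), with contraction ratios $r_1,\dots,r_M$, if $A=\bigcup_{m=1}^M\psi_m(A)$, where the union is disjoint. $A$ satisfies the open set condition if there is a bounded (nonempty) open set $V\subset\mathbb R^p$ with $\bigcup_{m=1}^M\psi_m(V)\subset V$, the sets in the union being disjoint. The Hausdorff dimension $d=\dim_H A$ of a self-similar fractal satisfies $\sum_{m=1}^M r_m^d=1$. $\mathcal H_d$ denotes $d$-dimensional Hausdorff measure. For a finite set $\omega_N=\{\boldsymbol x_1,\dots,\boldsymbol x_N\}$ of $N$ distinct points, $E_s(\omega_N):=\sum_{i\ne j}|\boldsymbol x_i-\boldsymbol x_j|^{-s}$ (sum over ordered pairs). For $N\ge2$, $\mathcal E_s(A,N):=\inf\{E_s(\omega_N):\omega_N\subset A,\ \#\omega_N=N\}$, and $$\underline g_{s,d}(A):=\liminf_{N\to\infty}\frac{\mathcal E_s(A,N)}{N^{1+s/d}}.$$ Weak$^*$ convergence $\mu_N\stackrel{*}{\longrightarrow}\mu$ of probability measures on $A$ means $\int_A f\,d\mu_N\to\int_A f\,d\mu$ for every $f\in C(A)$. *)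

(* Defs.v *)
From HB Require Import structures.
From mathcomp Require Export all_boot all_order all_algebra.
From mathcomp Require Export all_classical all_reals all_analysis.
Export Order.TTheory GRing.Theory Num.Theory.
Export numFieldNormedType.Exports.

Set Implicit Arguments.
Unset Strict Implicit.
Unset Printing Implicit Defensive.

Local Open Scope classical_set_scope.
Local Open Scope ring_scope.

Section euclidean.
Context {R : realType} {p : nat}.
Implicit Types (x y : 'rV[R]_p) (U V A E : set 'rV[R]_p).

(* The library norm on row vectors is the sup norm (it induces the same
   topology and the same bounded sets), hence this separate definition. *)
Definition enorm x : R := Num.sqrt (\sum_(i < p) x ord0 i ^+ 2).

(* Since points are row vectors, the orthogonal map acts on the right. *)
Definition similitude (r : R) (psi : 'rV[R]_p -> 'rV[R]_p) : Prop :=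
  0 < r < 1 /\
  exists (O : 'M[R]_p) (z : 'rV[R]_p),
    O *m O^T = 1%:M /\ forall x, psi x = r *: (x *m O) + z.

Definition self_similar_fractal (M : nat) (r : 'I_M -> R)
    (psi : 'I_M -> 'rV[R]_p -> 'rV[R]_p) A : Prop :=
  [/\ (2 <= M)%N, forall m, similitude (r m) (psi m), A !=set0 /\ compact A,
      A = \bigcup_m (psi m @` A) & trivIset setT (fun m => psi m @` A)].

Definition open_set_condition (M : nat)
    (psi : 'I_M -> 'rV[R]_p -> 'rV[R]_p) : Prop :=
  exists V, [/\ V !=set0, open V, bounded_set V,
    \bigcup_m (psi m @` V) `<=` V & trivIset setT (fun m => psi m @` V)].

(* Hausdorff measure for the Euclidean metric. No normalizing constant is put
   in front of the sums; it would cancel in [normalized_hausdorff]. *)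

(* Equal to -oo on the empty set. *)
Definition ediam U : \bar R :=
  ereal_sup [set (enorm (x - y))%:E | x in U & y in U].

(* The empty set has gauge 0 also for t = 0, where 0 `^ 0 = 1. *)
Definition hausdorff_gauge (t : R) U : \bar R :=
  if U == set0 then 0%E else poweR (ediam U) t.

Definition hausdorff_content (t delta : R) E : \bar R :=
  ereal_inf [set (\sum_(0 <= k <oo) hausdorff_gauge t (U k))%E | U in
    [set U : nat -> set 'rV[R]_p |
      E `<=` \bigcup_k U k /\ forall k, (ediam (U k) <= delta%:E)%E]].

(* The content is nonincreasing in delta, so the supremum is its limit as
   delta tends to 0. *)
Definition hausdorff_measure (t : R) E : \bar R :=
  ereal_sup [set hausdorff_content t delta E | delta in [set e : R | 0 < e]].

Definition hausdorff_dim E : \bar R :=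
  ereal_inf [set t%:E | t in [set t : R | 0 <= t /\ hausdorff_measure t E = 0%E]].

(* A set of N distinct points of A, given by an enumeration. *)
Definition configuration A (N : nat) (x : 'I_N -> 'rV[R]_p) : Prop :=
  injective x /\ forall i, A (x i).

Definition riesz_energy (s : R) (N : nat) (x : 'I_N -> 'rV[R]_p) : R :=
  \sum_(i < N) \sum_(j < N | j != i) enorm (x i - x j) `^ (- s).

Definition min_energy (s : R) A (N : nat) : \bar R :=
  ereal_inf [set (riesz_energy s x)%:E | x in @configuration A N].

Definition lower_g (s d : R) A : \bar R :=
  limn_einf (fun N => min_energy s A N / (N%:R `^ (1 + s / d))%:E)%E.

(* R^p with its Borel sigma-algebra. *)
Definition borel := g_sigma_algebraType (@open 'rV[R]_p).

Definition empirical_measure (N : nat) (x : 'I_N -> borel)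
    (B : set borel) : \bar R :=
  ((N%:R^-1)%:E * \sum_(i < N) \d_(x i) B)%E.

Definition normalized_hausdorff (d : R) (A B : set borel) : \bar R :=
  (hausdorff_measure d (B `&` A) / hausdorff_measure d A)%E.

(* The integral is that of the library, which is defined for any set function
   on the measurable sets, here the Borel sets; [hausdorff_measure d] is a
   measure on these, being a metric outer measure. *)
Definition weak_star_cvg A (F : set_system nat)
    (nu : nat -> set borel -> \bar R) (mu : set borel -> \bar R) : Prop :=
  forall f : 'rV[R]_p -> R, {within A, continuous f} ->
    (\int[nu N]_(x in A) (f x)%:E)%E @[N --> F] -->
      (\int[mu]_(x in A) (f x)%:E)%E.

End euclidean.

(* Main.v *)
From HB Require Import structures.
Require Import Defs.
From mathcomp Require Import ring lra measurable_realfun.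

(** Write [a = 1 + s / d]. The part of a configuration that lies in a cylinder
  of contraction ratio [c] is the image under a similitude of a configuration
  in [A], so its energy is [c `^ (- s)] times the energy of the latter.
  Dropping the interactions between different cylinders of one level, one finds
  that a configuration with the proportion [alpha_c] of its [N] points in each
  cylinder has energy at least about
    [g * N `^ a * \sum_c c `^ (- s) * alpha_c `^ a],
  where [g] is the lower limit of the normalized minimal energies. By Moran's
  equation the numbers [c `^ d] sum to one, as do the proportions, and by strict
  convexity the sum above is at least [1], with equality only for
  [alpha_c = c `^ d]. Hence configurations whose normalized energy tends to [g]
  put asymptotically the proportion [c `^ d] of their points into each cylinder.
  [seq_energy_excess] is a quantitative form of this argument, and
  [equidistribution] its conclusion.

  The argument divides by [g], so [g] has to be positive and finite. Positivity
  follows from the pigeonhole principle, applied to a cover by cylinders of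
  nearly equal size ([seq_energy_ge]). Finiteness follows from a recursive
  construction: configurations made for coarser scales are transported to
  the pieces of [A] and united ([seq_energy_le]).

  The limit proportions are the masses of the cylinders under the normalized
  Hausdorff measure ([normalized_hausdorff_ifs]), and a continuous function is
  almost constant on the cylinders of a deep level, so the convergence of
  the proportions implies weak convergence ([weak_star_cvg_cylinders]).

  What concerns Hausdorff measure rests on the positive distance between the
  pieces of [A], which are disjoint and compact. It implies that a small set
  meets [A] inside a cylinder of comparable size ([cylinder_capture]), so that
  the measure of [A] in the dimension given by Moran's equation is positive;
  consequently this is the Hausdorff dimension ([hausdorff_dim_ifs]). It also
  makes cylinders, and with them all Borel sets, Caratheodory measurable for
  the Hausdorff measure restricted to [A] ([borel_caratheodory]). *)

Set Implicit Arguments.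
Unset Strict Implicit.
Unset Printing Implicit Defensive.

Local Open Scope classical_set_scope.
Local Open Scope ring_scope.

(** * The Euclidean norm and dilations *)

Section enorm_theory.
Context {R : realType} {p : nat}.
Implicit Types (x y : 'rV[R]_p) (K A : set 'rV[R]_p) (f : 'rV[R]_p -> 'rV[R]_p).

Lemma enorm_ge0 x : 0 <= enorm x.
Proof. exact: sqrtr_ge0. Qed.

Lemma enorm0 : enorm (0 : 'rV[R]_p) = 0.
Proof.
by rewrite /enorm big1 ?sqrtr0// => i _; rewrite mxE expr0n.
Qed.

Lemma mx_norm_le_enorm x : `|x| <= enorm x.
Proof.
rewrite [leLHS]/Num.Def.normr/= mx_normrE bigmax_le ?enorm_ge0// => -[i j] _ /=.
rewrite (ord1 i) -sqrtr_sqr ler_wsqrtr// (bigD1 j)//= lerDl.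
by apply: sumr_ge0 => k _; exact: sqr_ge0.
Qed.

Lemma enorm_eq0 x : enorm x = 0 -> x = 0.
Proof.
move=> x0; apply/eqP; rewrite -normr_eq0 eq_le normr_ge0 andbT -x0.
exact: mx_norm_le_enorm.
Qed.

Lemma enorm_gt0 x y : x != y -> 0 < enorm (x - y).
Proof.
move=> xy; rewrite lt0r enorm_ge0 andbT; apply: contra xy => /eqP/enorm_eq0.
by move/eqP; rewrite subr_eq0.
Qed.

Lemma enormE x : enorm x = Num.sqrt ((x *m x^T) ord0 ord0).
Proof. by congr Num.sqrt; rewrite mxE; apply: eq_bigr => i _; rewrite mxE expr2. Qed.

Lemma enorm_orthogonal (O : 'M[R]_p) x : O *m O^T = 1%:M -> enorm (x *m O) = enorm x.
Proof. by move=> OO; rewrite !enormE trmx_mul mulmxA -(mulmxA x) OO mulmx1. Qed.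

Lemma enormZ (a : R) x : 0 <= a -> enorm (a *: x) = a * enorm x.
Proof.
move=> a0; rewrite /enorm -{2}(ger0_norm a0) -sqrtr_sqr -sqrtrM ?sqr_ge0//.
by congr Num.sqrt; rewrite mulr_sumr; apply: eq_bigr => i _; rewrite mxE exprMn.
Qed.

Lemma enorm_continuous : continuous (@enorm R p).
Proof.
move=> x; apply: (@continuous_comp _ _ _ _ (@Num.sqrt R)); last exact: sqrt_continuous.
move: x; apply: (continuous_big (op := +%R)) => [|i _ x]; first exact: add_continuous.
apply: (@continuous_comp _ _ _ (fun x : 'rV[R]_p => x ord0 i) (fun u : R => u ^+ 2)).
  exact: coord_continuous.
exact: exprn_continuous.
Qed.

Lemma edist_continuous : continuous (fun u : 'rV[R]_p * 'rV[R]_p => enorm (u.1 - u.2)).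
Proof.
move=> u; apply: (@continuous_comp _ _ _ (fun u : 'rV[R]_p * 'rV[R]_p => u.1 - u.2) enorm).
  by apply: cvgB; [exact: cvg_fst|exact: cvg_snd].
exact: enorm_continuous.
Qed.

(** The distance attains its minimum on the product, and vanishes only on the
  diagonal. *)
Lemma compact_separated K1 K2 : compact K1 -> compact K2 -> K1 `&` K2 = set0 ->
  exists2 e : R, 0 < e & forall x y, K1 x -> K2 y -> e <= enorm (x - y).
Proof.
move=> cK1 cK2 K12; have [K0|] := pselect ((K1 `*` K2) !=set0); last first.
  move=> K0; exists 1 => // x y K1x K2y.
  by exfalso; apply: K0; exists (x, y).
have [[a b]] := compact_EVT_min K0 (compact_setX cK1 cK2)
  (continuous_subspaceT edist_continuous).
rewrite inE => -[/= K1a K2b] h.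
exists (enorm (a - b)).
  apply: enorm_gt0; apply/eqP => ab.
  have : (K1 `&` K2) a by split=> //; rewrite ab.
  by rewrite K12.
by move=> x y K1x K2y; apply: (h (x, y)); rewrite inE.
Qed.

Lemma compact_ediam K : compact K ->
  exists2 D : R, 0 < D & forall x y, K x -> K y -> enorm (x - y) <= D.
Proof.
move=> cK; have [K0|] := pselect ((K `*` K) !=set0); last first.
  move=> K0; exists 1 => // x y Kx Ky.
  by exfalso; apply: K0; exists (x, y).
have [[a b]] := compact_EVT_max K0 (compact_setX cK cK)
  (continuous_subspaceT edist_continuous).
rewrite inE => -[/= Ka Kb] h.
exists (1 + enorm (a - b)); first by rewrite ltr_wpDr ?enorm_ge0.
by move=> x y Kx Ky; rewrite ler_wpDl//; apply: (h (x, y)); rewrite inE.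
Qed.

(** Of a similitude, only its effect on distances matters below. *)
Definition dilation (c : R) f := forall x y, enorm (f x - f y) = c * enorm (x - y).

Lemma similitude_dilation (c : R) f : similitude c f -> dilation c f.
Proof.
move=> [/andP[c0 _] [Q [z [QQ fE]]]] x y.
rewrite !fE opprD addrACA subrr addr0 -scalerBr -mulmxBl enormZ ?ltW//.
by rewrite enorm_orthogonal.
Qed.

Lemma dilation_inj (c : R) f : 0 < c -> dilation c f -> injective f.
Proof.
move=> c0 fc x y fxy; apply/eqP; rewrite -subr_eq0; apply/eqP/enorm_eq0.
have := fc x y; rewrite fxy subrr enorm0 => /esym/eqP.
by rewrite mulf_eq0 gt_eqF//= => /eqP.
Qed.

Lemma dilation_continuous (c : R) f : dilation c f -> continuous f.
Proof.
move=> fc x; apply/(@cvgrPdist_le _ _ _ (nbhs x)) => e e0.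
have cd : continuous (fun y => c * enorm (x - y)).
  move=> y; apply: (@continuous_comp _ _ _ (fun y => x - y) (fun v => c * enorm v)).
    by apply: (@continuousB _ _ _ (cst x) id); [exact: cst_continuous|by move=> ?].
  by apply: (@continuousM _ _ (cst c)); [exact: cst_continuous|exact: enorm_continuous].
have : (fun y => c * enorm (x - y)) y @[y --> x] --> c * enorm (x - x) := cd x.
rewrite subrr enorm0 mulr0 => /cvgrPdist_le /(_ _ e0).
apply: filterS => y; rewrite sub0r normrN -fc ger0_norm ?enorm_ge0//.
exact/le_trans/mx_norm_le_enorm.
Qed.

Lemma dilation_comp (b c : R) f g : dilation b f -> dilation c g ->
  dilation (b * c) (f \o g).
Proof. by move=> fb gc x y /=; rewrite fb gc mulrA. Qed.

End enorm_theory.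

(** * Cylinders of a separated iterated function system *)

Section words.
Context {R : realType} {p : nat} {I : finType}.
Context (r : I -> R) (f : I -> 'rV[R]_p -> 'rV[R]_p) (A : set 'rV[R]_p).
Implicit Types (w u v : seq I) (x y : 'rV[R]_p) (L : seq (seq I)).

(** Disjointness of the pieces is expressed as uniqueness of the first letter in
  the coding of a point, which is how it is used on words. *)
Definition separated_ifs : Prop :=
  [/\ forall i, 0 < r i < 1, forall i, dilation (r i) (f i),
      A !=set0 /\ compact A, A = \bigcup_i (f i @` A) &
      forall i j x y, A x -> A y -> f i x = f j y -> i = j].

Definition word_map w : 'rV[R]_p -> 'rV[R]_p := foldr (fun i g => f i \o g) id w.
Definition word_ratio w : R := \prod_(i <- w) r i.
Definition cylinder w : set 'rV[R]_p := word_map w @` A.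

Fixpoint words (n : nat) : seq (seq I) :=
  if n is n'.+1 then [seq i :: w | i <- enum I, w <- words n'] else [:: [::]].

Lemma mem_words n w : (w \in words n) = (size w == n).
Proof.
elim: n w => [|n IHn] [|i w] //=.
  by apply/allpairsP => -[[j u] /= [_ _]].
rewrite eqSS -IHn; apply/allpairsP/idP => [[[j u] /= [_ un [_ ->]]]//|wn].
by exists (i, w); rewrite mem_enum.
Qed.

Lemma uniq_words n : uniq (words n).
Proof.
elim: n => //= n IHn; apply: allpairs_uniq => //; first exact: enum_uniq.
by move=> [i u] [j v] _ _ /= [-> ->].
Qed.

Lemma word_map_cat u v x : word_map (u ++ v) x = word_map u (word_map v x).
Proof. by elim: u => //= i u ->. Qed.

Lemma word_ratio_nil : word_ratio [::] = 1.
Proof. exact: big_nil. Qed.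

Lemma word_ratio_cons i w : word_ratio (i :: w) = r i * word_ratio w.
Proof. exact: big_cons. Qed.

Lemma cylinder_nil : cylinder [::] = A.
Proof. exact: image_id. Qed.

Context (SA : separated_ifs).

Let r_gt0 i : 0 < r i. Proof. by case: SA => /(_ i)/andP[]. Qed.
Let r_lt1 i : r i < 1. Proof. by case: SA => /(_ i)/andP[]. Qed.

Lemma word_ratio_gt0 w : 0 < word_ratio w.
Proof. by apply: prodr_gt0 => i _; exact: r_gt0. Qed.

Lemma max_ratio : exists2 c : R, 0 < c < 1 & forall i, r i <= c.
Proof.
have [i0|I0] := pickP (@predT I); last first.
  by exists 2^-1; [lra|move=> i; have := I0 i].
move=> _; pose j := [arg max_(j > i0) r j]%O.
exists (r j); first by rewrite r_gt0 r_lt1.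
by move=> i; rewrite /j; case: arg_maxP => // k _; exact.
Qed.

Lemma word_ratio_expr (c : R) w : (forall i, r i <= c) -> word_ratio w <= c ^+ size w.
Proof.
move=> rc; elim: w => [|i w IHw]; first by rewrite word_ratio_nil.
by rewrite word_ratio_cons exprS ler_pM// ltW// word_ratio_gt0.
Qed.

Lemma word_ratio_small (e : R) : 0 < e ->
  exists n, forall w, (n <= size w)%N -> word_ratio w <= e.
Proof.
move=> e0; have [c /andP[c0 c1] rc] := max_ratio.
have : c ^+ n @[n --> \oo] --> 0 by apply: cvg_expr; rewrite gtr0_norm.
move=> /cvgrPdist_le/(_ _ e0)[n _ nP]; exists n => w nw.
apply: (le_trans (word_ratio_expr w rc)); have := nP _ nw.
by rewrite sub0r normrN ger0_norm// exprn_ge0// ltW.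
Qed.

Lemma ifs_inj i : injective (f i).
Proof. by apply: (@dilation_inj _ _ (r i)); [exact: r_gt0|case: SA]. Qed.

Lemma word_map_dilation w : dilation (word_ratio w) (word_map w).
Proof.
elim: w => [|i w IHw]; first by move=> x y; rewrite word_ratio_nil mul1r.
by rewrite word_ratio_cons; apply: dilation_comp => //; case: SA.
Qed.

Lemma word_map_continuous w : continuous (word_map w).
Proof. exact: dilation_continuous (word_map_dilation w). Qed.

Lemma ifs_sub i x : A x -> A (f i x).
Proof. by move=> Ax; case: SA => _ _ _ -> _; exists i => //; exists x. Qed.

Lemma word_map_sub w x : A x -> A (word_map w x).
Proof. by move=> Ax; elim: w => //= i w IHw; exact: ifs_sub. Qed.

Lemma cylinder_sub w : cylinder w `<=` A.
Proof. by move=> _ [x Ax <-]; exact: word_map_sub. Qed.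

Lemma cylinder_cat_sub u v : cylinder (u ++ v) `<=` cylinder u.
Proof.
move=> _ [x Ax <-]; rewrite word_map_cat; exists (word_map v x) => //.
exact: word_map_sub.
Qed.

Lemma cylinder_cons i w : cylinder (i :: w) = f i @` cylinder w.
Proof. by rewrite /cylinder image_comp. Qed.

Lemma ifs_split x : A x -> exists i, exists2 y, A y & f i y = x.
Proof.
have [_ _ _ AE _] := SA; rewrite {1}AE => -[i _ [y Ay <-]].
by exists i; exists y.
Qed.

Lemma words_cover n x : A x -> exists2 w, size w = n & cylinder w x.
Proof.
elim: n x => [|n IHn] x Ax; first by exists [::]; rewrite ?cylinder_nil.
have [i [y Ay <-]] := ifs_split Ax; have [w wn wy] := IHn _ Ay.
by exists (i :: w) => /=; [rewrite wn|rewrite cylinder_cons; exists y].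
Qed.

Lemma cylinder_rcons w x : cylinder w x -> exists i, cylinder (rcons w i) x.
Proof.
move=> [_ /ifs_split[i [y Ay <-]] <-]; exists i; exists y => //.
by rewrite -cats1 word_map_cat.
Qed.

Lemma ifs_eq i j x y : A x -> A y -> f i x = f j y -> i = j.
Proof. by case: SA => _ _ _ _; apply. Qed.

(** A point of [A] has one coding of each length. *)
Lemma word_map_eq u v x y : size u = size v -> A x -> A y ->
  word_map u x = word_map v y -> u = v.
Proof.
move=> + Ax Ay; elim: u v => [|i u IHu] [|j v]//= [uv] fuv.
have ij : i = j by apply: ifs_eq fuv; exact: word_map_sub.
rewrite -ij in fuv *; congr (_ :: _); apply: IHu => //.
exact: ifs_inj fuv.
Qed.

Lemma compact_cylinder w : compact (cylinder w).
Proof.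
apply: continuous_compact; last by case: SA => _ _ [].
exact/continuous_subspaceT/word_map_continuous.
Qed.

(** The rest of a cylinder consists of the other pieces and of the image of the
  rest of a shorter cylinder. So cylinders are relatively open in [A]. *)
Lemma compact_setD_cylinder w : compact (A `\` cylinder w).
Proof.
elim: w => [|i w IHw]; first by rewrite cylinder_nil setDv; exact: compact0.
have -> : A `\` cylinder (i :: w) =
  \big[setU/set0]_(j <- enum I | j != i) cylinder [:: j] `|` f i @` (A `\` cylinder w).
  apply/seteqP; split => x.
    move=> [Ax nx]; have [j [y Ay yx]] := ifs_split Ax.
    have [ji|ji] := eqVneq j i; last first.
      left; rewrite -bigcup_seq_cond; exists j; first by rewrite /= mem_enum.
      by exists y.
    right; exists y; rewrite -?ji//; split => // wy.
    by apply: nx; rewrite cylinder_cons; exists y; rewrite -?ji.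
  case.
    rewrite -bigcup_seq_cond => -[j /andP[_ ji] [y Ay <-]].
    split; first exact: ifs_sub.
    rewrite cylinder_cons => -[z /cylinder_sub Az /esym/ifs_eq ij].
    by move: ji; rewrite ij ?eqxx.
  move=> [y [Ay ny] <-]; split; first exact: ifs_sub.
  rewrite cylinder_cons => -[z wz fzy]; apply: ny.
  have -> // : y = z.
  exact/esym/(ifs_inj fzy).
apply: compactU.
  by apply: bigsetU_compact => j _; exact: compact_cylinder.
apply: continuous_compact => //; apply: continuous_subspaceT.
by case: SA => _ /(_ i)/dilation_continuous.
Qed.

(** The complements of the compact sets [A `\` cylinder f A (W k)] form an open
  cover of [A]. *)
Lemma cylinder_finite_subcover (W : nat -> seq I) :
  A `<=` \bigcup_k cylinder (W k) ->
  exists n, A `<=` \bigcup_(k < n) cylinder (W k).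
Proof.
move=> cov; have [_ _ [_ cA] _ _] := SA.
pose G k := ~` (A `\` cylinder (W k)).
move: (cA); rewrite compact_cover => /(_ _ setT G)[].
- move=> k _; apply: closed_openC; apply: compact_closed.
    exact: norm_hausdorff.
  exact: compact_setD_cylinder.
- by move=> x Ax; have [k _ wx] := cov _ Ax; exists k => // -[].
move=> D _ AD; exists (\max_(k <- finmap.enum_fset D) k).+1 => x Ax.
have [k kD Gx] := AD _ Ax; exists k; last first.
  by apply: contrapT => nx; exact: Gx.
by rewrite /= ltnS; apply: (@leq_bigmax_seq _ _ xpredT id).
Qed.

(** The weights [r i `^ t] distribute a unit mass over the words of each length,
  and a cover has to carry all of it. The induction is on the length of the
  longest word: a cover without the empty word splits by first letters into
  images of covers of [A] by shorter words. *)
Lemma cylinder_cover_mass (t : R) L : \sum_i r i `^ t = 1 ->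
  A `<=` \bigcup_(w in [set` L]) cylinder w ->
  1 <= \sum_(w <- L) word_ratio w `^ t.
Proof.
move=> rt1; have [n] : exists n, forall w, w \in L -> (size w <= n)%N.
  exists (\max_(w <- L) size w) => w wL.
  by apply: (@leq_bigmax_seq _ _ xpredT size).
elim: n L => [|n IHn] L Ln cov.
all: have [nilL|nilL] := boolP ([::] \in L).
1,3: by rewrite (perm_big _ (perm_to_rem nilL))/= big_cons word_ratio_nil powR1
  lerDl sumr_ge0// => w _; exact: powR_ge0.
  have [_ _ [[x Ax] _] _ _] := SA.
  have [w wL _] := cov _ Ax; have := Ln _ wL.
  by case: w wL => // h; rewrite /= h in nilL.
pose tails i := [seq behead w | w <- L & ohead w == Some i].
have h i : 1 <= \sum_(w <- tails i) word_ratio w `^ t.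
  apply: IHn => [_ /mapP[w + ->]|x Ax].
    by rewrite mem_filter size_behead -subn1 leq_subLR add1n => /andP[_ /Ln].
  have [w wL] := cov _ (ifs_sub i Ax).
  case: w wL => [|j w] jwL; first by rewrite /= jwL in nilL.
  rewrite cylinder_cons => -[y wy fyx].
  have ji : j = i by apply: ifs_eq fyx => //; exact: cylinder_sub wy.
  have xy : y = x.
    by rewrite ji in fyx; exact: ifs_inj fyx.
  exists w; last by rewrite -xy.
  by apply/mapP; exists (j :: w) => //; rewrite mem_filter /= ji eqxx -ji.
have -> : \sum_(w <- L) word_ratio w `^ t =
    \sum_i r i `^ t * \sum_(w <- tails i) word_ratio w `^ t.
  apply/esym; under eq_bigr do rewrite mulr_sumr big_map big_filter big_mkcond.
  rewrite exchange_big/=; apply: eq_big_seq => w wL.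
  case: w wL => [|j w] jwL; first by rewrite jwL in nilL.
  rewrite (bigD1 j)//= eqxx big1 ?addr0 => [|i ij]; last first.
    by case: eqP => // -[ji]; rewrite ji eqxx in ij.
  by rewrite word_ratio_cons powRM// ltW// word_ratio_gt0.
by rewrite -rt1; apply: ler_sum => i _; rewrite ler_peMr// powR_ge0.
Qed.

Lemma sum_words (t : R) n :
  \sum_(w <- words n) word_ratio w `^ t = (\sum_i r i `^ t) ^+ n.
Proof.
elim: n => [|n IHn]; first by rewrite big_seq1 word_ratio_nil powR1.
rewrite /= big_allpairs_dep exprS -IHn mulr_suml big_enum/=; apply: eq_bigr => i _.
rewrite mulr_sumr; apply: eq_bigr => w _.
by rewrite word_ratio_cons powRM// ltW// word_ratio_gt0.
Qed.

Lemma ifs_separation : exists2 e : R, 0 < e &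
  forall i j x y, i != j -> A x -> A y -> e <= enorm (f i x - f j y).
Proof.
have h (ij : I * I) : exists e : R, 0 < e /\ (ij.1 != ij.2 ->
    forall x y, A x -> A y -> e <= enorm (f ij.1 x - f ij.2 y)).
  have [ij0|ij0] := eqVneq ij.1 ij.2; first by exists 1.
  have [|e e0 he] := compact_separated
    (@compact_cylinder [:: ij.1]) (@compact_cylinder [:: ij.2]).
    rewrite -subset0 => x [[y Ay <-] [z Az /ifs_eq zy]].
    by rewrite zy ?eqxx in ij0.
  by exists e; split => // _ x y Ax Ay; apply: he; [exists x|exists y].
have [e eP] := choice h.
exists (\big[Num.min/1]_ij e ij).
  by apply: lt_bigmin => // ij _; case: (eP ij).
move=> i j x y ij Ax Ay; have [_ /(_ ij)] := eP (i, j).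
by move=> /(_ x y Ax Ay); apply: le_trans; exact: bigmin_le_cond.
Qed.

(** Descend along cylinders for as long as the set is shorter than the gap between
  the children of the current cylinder: it then meets only one of them. *)
Lemma cylinder_capture (e rho eps : R) (U : set 'rV[R]_p) : 0 < eps ->
  (forall i j x y, i != j -> A x -> A y -> e <= enorm (f i x - f j y)) ->
  (forall x y, U x -> U y -> enorm (x - y) <= rho) ->
  exists2 w, U `&` A `<=` cylinder w &
    e * word_ratio w <= rho \/ word_ratio w <= eps.
Proof.
move=> eps0 he hU; have [n nP] := word_ratio_small eps0.
suff [w Uw [|]] : exists2 w, U `&` A `<=` cylinder w &
    e * word_ratio w <= rho \/ size w = n.
- by move=> h; exists w => //; left.
- by move=> wn; exists w => //; right; rewrite nP// wn.
elim: n {nP} => [|n [w Uw [h|wn]]].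
- by exists [::]; [rewrite cylinder_nil => x []|right].
- by exists w => //; left.
have [h|h] := leP (e * word_ratio w) rho; first by exists w => //; left.
have [[x [Ux Ax]]|U0] := pselect (U `&` A !=set0); last first.
  have [i [y Ay _]] : exists i : I, exists2 y, A y & True.
    have [_ _ [[x Ax] _] _ _] := SA.
    by have [i [y Ay _]] := ifs_split Ax; exists i; exists y.
  exists (rcons w i); last by right; rewrite size_rcons wn.
  by move=> x Ux; exfalso; apply: U0; exists x.
have [i ix] := cylinder_rcons (Uw _ (conj Ux Ax)).
exists (rcons w i); last by right; rewrite size_rcons wn.
move=> y [Uy Ay]; have [j jy] := cylinder_rcons (Uw _ (conj Uy Ay)).
have [<-//|ij] := eqVneq j i.
case: ix jy => x' Ax' x'E [y' Ay' y'E].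
have := hU _ _ Uy Ux; rewrite -x'E -y'E -!cats1 !word_map_cat word_map_dilation/=.
move=> /(le_trans (ler_wpM2l (ltW (word_ratio_gt0 w)) (he _ _ _ _ ij Ay' Ax'))).
by rewrite mulrC leNgt h.
Qed.

End words.

(** * Hausdorff content and Hausdorff measure *)

Section hausdorff.
Context {R : realType} {p : nat}.
Implicit Types (x y : 'rV[R]_p) (U V E : set 'rV[R]_p) (t delta : R).
Local Open Scope ereal_scope.

Lemma ediam_le U (rho : R) :
  (forall x y, U x -> U y -> (enorm (x - y) <= rho)%R) -> ediam U <= rho%:E.
Proof. by move=> h; apply: ge_ereal_sup => _ [x Ux [y Uy <-]]; rewrite lee_fin h. Qed.

Lemma le_ediam x y U : U x -> U y -> (enorm (x - y))%:E <= ediam U.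
Proof. by move=> Ux Uy; apply: ereal_sup_ubound; exists x => //; exists y. Qed.

Lemma ediam_ge0 x U : U x -> 0 <= ediam U.
Proof.
move=> Ux; apply: le_trans (le_ediam Ux Ux).
by rewrite lee_fin enorm_ge0.
Qed.

Lemma hausdorff_gauge0 t : hausdorff_gauge t (set0 : set 'rV[R]_p) = 0.
Proof. by rewrite /hausdorff_gauge eqxx. Qed.

Lemma hausdorff_gauge_ge0 t U : 0 <= hausdorff_gauge t U.
Proof. by rewrite /hausdorff_gauge; case: ifP => // _; exact: poweR_ge0. Qed.

Lemma hausdorff_gaugeE t U x : U x -> hausdorff_gauge t U = ediam U `^ t.
Proof. by move=> Ux; rewrite /hausdorff_gauge ifF//; apply/eqP => U0; rewrite U0 in Ux. Qed.

Lemma poweR_le (a b : \bar R) t : (0 <= t)%R -> 0 <= a -> a <= b -> a `^ t <= b `^ t.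
Proof.
move=> t0 a0 ab; apply: gt0_ler_poweR => //; rewrite in_itv/= leey andbT//.
exact: le_trans ab.
Qed.

(** A correspondence between points, instead of a map, so that [V] can be the
  image or the preimage of [U] under a dilation. *)
Lemma ediam_lipschitz (c : R) U V : (0 < c)%R ->
  (forall x y, V x -> V y -> exists x' y',
     [/\ U x', U y' & (enorm (x - y) <= c * enorm (x' - y'))%R]) ->
  ediam V <= c%:E * ediam U.
Proof.
move=> c0 h; apply: ge_ereal_sup => _ [x Vx [y Vy <-]].
have [x' [y' [Ux' Uy' le]]] := h _ _ Vx Vy.
apply: (@le_trans _ _ (c%:E * (enorm (x' - y'))%:E)); first by rewrite -EFinM lee_fin.
by apply: lee_wpmul2l; [rewrite lee_fin ltW|exact: le_ediam].
Qed.

Lemma hausdorff_gauge_lipschitz t (c : R) U V : (0 <= t)%R -> (0 < c)%R ->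
  (forall x y, V x -> V y -> exists x' y',
     [/\ U x', U y' & (enorm (x - y) <= c * enorm (x' - y'))%R]) ->
  hausdorff_gauge t V <= (c `^ t)%:E * hausdorff_gauge t U.
Proof.
move=> t0 c0 h; have [[x Vx]|/nonemptyPn ->] := pselect (V !=set0); last first.
  by rewrite hausdorff_gauge0 mule_ge0 ?hausdorff_gauge_ge0// lee_fin powR_ge0.
have [x' [_ [Ux' _ _]]] := h _ _ Vx Vx.
rewrite (hausdorff_gaugeE _ Vx) (hausdorff_gaugeE _ Ux') -poweR_EFin -poweRM ?(ediam_ge0 Ux')//.
  by apply: poweR_le; rewrite ?(ediam_ge0 Vx)//; exact: ediam_lipschitz.
by rewrite lee_fin ltW.
Qed.

Lemma le_hausdorff_content t delta E E' : E `<=` E' ->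
  hausdorff_content t delta E <= hausdorff_content t delta E'.
Proof.
move=> EE'; apply: ereal_inf_le_tmp => _ [U [cU dU] <-].
by exists U => //; split => //; exact: subset_trans cU.
Qed.

Lemma hausdorff_content_ge0 t delta E : 0 <= hausdorff_content t delta E.
Proof.
apply: le_ereal_inf_tmp => _ [U _ <-]; apply: nneseries_ge0 => k _ _.
exact: hausdorff_gauge_ge0.
Qed.

Lemma hausdorff_content_anti t delta delta' E : (delta <= delta')%R ->
  hausdorff_content t delta' E <= hausdorff_content t delta E.
Proof.
move=> dd'; apply: ereal_inf_le_tmp => _ [U [cU dU] <-].
by exists U => //; split => // k; apply: le_trans (dU k) _; rewrite lee_fin.
Qed.

Lemma hausdorff_content_le_sum t delta E (L : seq (set 'rV[R]_p)) :
  E `<=` \bigcup_(U in [set` L]) U ->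
  (forall U, U \in L -> ediam U <= delta%:E) ->
  hausdorff_content t delta E <= \sum_(U <- L) hausdorff_gauge t U.
Proof.
move=> cov dL; pose F k := nth set0 L k.
have -> : \sum_(U <- L) hausdorff_gauge t U = \sum_(0 <= k <oo) hausdorff_gauge t (F k).
  rewrite (nneseries_split _ (size L)); last by move=> *; exact: hausdorff_gauge_ge0.
  rewrite [X in _ + X]eseries0 ?adde0; last first.
    by move=> k Lk _; rewrite /F nth_default// hausdorff_gauge0.
  by rewrite add0n (big_nth set0).
apply: ereal_inf_lbound; exists F => //; split=> [x /cov[U LU Ux]|k].
  by exists (index U L) => //; rewrite /F nth_index.
have [kL|Lk] := ltnP k (size L); first by rewrite dL// mem_nth.
rewrite /F nth_default//; apply: ge_ereal_sup => y [x [] ].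
Qed.

Lemma hausdorff_content0 t delta : hausdorff_content t delta (set0 : set 'rV[R]_p) = 0.
Proof.
apply/eqP; rewrite eq_le hausdorff_content_ge0 andbT.
by have := @hausdorff_content_le_sum t delta set0 [::]; rewrite big_nil; apply.
Qed.

(** An infinite gauge on large sets turns the bound on the diameters into a part
  of the set function; the content is then the outer measure generated by a set
  function on the discrete sigma-algebra. *)
Let small_gauge t delta (U : set (g_sigma_algebraType [set: set 'rV[R]_p])) : \bar R :=
  if ediam (U : set 'rV[R]_p) <= delta%:E then hausdorff_gauge t (U : set 'rV[R]_p) else +oo.

Let small_gauge_ge0 t delta U : 0 <= small_gauge t delta U.
Proof. by rewrite /small_gauge; case: ifP => _//; exact: hausdorff_gauge_ge0. Qed.

Let hausdorff_contentE t delta E :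
  hausdorff_content t delta E = mu_ext (small_gauge t delta) E.
Proof.
apply/eqP; rewrite eq_le; apply/andP; split.
- apply: le_ereal_inf_tmp => _ [U [_ cU] <-].
  have [dU|/existsNP[k /negP dk]] := pselect (forall k, ediam (U k) <= delta%:E).
    apply: ereal_inf_lbound; exists U => //.
    by apply: eq_eseriesr => k _; rewrite /small_gauge dU.
  rewrite (@eseries_pinfty _ _ xpredT k) ?leey//.
  - by move=> n _; rewrite -ltNye (lt_le_trans _ (small_gauge_ge0 _ _ _)).
  - by rewrite /small_gauge (negbTE dk).
- apply: ereal_inf_le_tmp => _ [U [cU dU] <-]; exists U.
    by split => // k; exact: sub_gen_smallest.
  by apply: eq_eseriesr => k _; rewrite /small_gauge dU.
Qed.

Lemma hausdorff_content_sigma_subadditive t delta :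
  sigma_subadditive (@hausdorff_content R p t delta).
Proof.
have -> : @hausdorff_content R p t delta = mu_ext (small_gauge t delta).
  by apply/funext => E; exact: hausdorff_contentE.
apply: (@mu_ext_sigma_subadditive _ (g_sigma_algebraType [set: set 'rV[R]_p])).
exact: small_gauge_ge0.
Qed.

(** The images [phi (U k)] of the sets of a cover of [E] form a cover of [E'], with
  diameters multiplied by at most [c]. *)
Lemma hausdorff_content_lipschitz t (c delta : R) E E' (phi : set 'rV[R]_p -> set 'rV[R]_p) :
  (0 <= t)%R -> (0 < c)%R ->
  (forall U x y, phi U x -> phi U y -> exists x' y',
     [/\ U x', U y' & (enorm (x - y) <= c * enorm (x' - y'))%R]) ->
  (forall U : nat -> set 'rV[R]_p, E `<=` \bigcup_k U k -> E' `<=` \bigcup_k phi (U k)) ->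
  hausdorff_content t (c * delta) E' <= (c `^ t)%:E * hausdorff_content t delta E.
Proof.
move=> t0 c0 hphi cov; rewrite -ereal_inf_pZl ?powR_gt0//.
apply: le_ereal_inf_tmp => _ [_ [U [cU dU] <-] <-].
apply: (@le_trans _ _ (\sum_(0 <= k <oo) hausdorff_gauge t (phi (U k)))).
  apply: ereal_inf_lbound; exists (fun k => phi (U k)) => //; split; first exact: cov.
  move=> k; apply: le_trans (ediam_lipschitz c0 (hphi (U k))) _.
  by rewrite EFinM lee_wpmul2l// lee_fin ltW.
rewrite -nneseriesZl//; last by move=> *; exact: hausdorff_gauge_ge0.
by apply: lee_nneseries => k *; [exact: hausdorff_gauge_ge0|apply: hausdorff_gauge_lipschitz => //; exact: hphi].
Qed.

Lemma hausdorff_content_le t delta E : (0 < delta)%R ->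
  hausdorff_content t delta E <= hausdorff_measure t E.
Proof. by move=> d0; apply: ereal_sup_ubound; exists delta. Qed.

Lemma hausdorff_measure_ge0 t E : 0 <= hausdorff_measure t E.
Proof.
exact: le_trans (hausdorff_content_ge0 t 1 E) (hausdorff_content_le _ _ ltr01).
Qed.

Lemma hausdorff_measure0 t : hausdorff_measure t (set0 : set 'rV[R]_p) = 0.
Proof.
apply/eqP; rewrite eq_le hausdorff_measure_ge0 andbT.
by apply: ge_ereal_sup => _ [e _ <-]; rewrite hausdorff_content0.
Qed.

Lemma le_hausdorff_measure t E E' : E `<=` E' ->
  hausdorff_measure t E <= hausdorff_measure t E'.
Proof.
move=> EE'; apply: ge_ereal_sup => _ [e e0 <-].
exact: le_trans (le_hausdorff_content _ _ EE') (hausdorff_content_le _ _ e0).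
Qed.

Lemma hausdorff_measure_sigma_subadditive t :
  sigma_subadditive (@hausdorff_measure R p t).
Proof.
move=> F; apply: ge_ereal_sup => _ [e e0 <-].
apply: le_trans (hausdorff_content_sigma_subadditive _ _ _) _.
by apply: lee_nneseries => k *; [exact: hausdorff_content_ge0|exact: hausdorff_content_le].
Qed.

Lemma hausdorff_measure_lipschitz t (c : R) E E' (phi : set 'rV[R]_p -> set 'rV[R]_p) :
  (0 <= t)%R -> (0 < c)%R ->
  (forall U x y, phi U x -> phi U y -> exists x' y',
     [/\ U x', U y' & (enorm (x - y) <= c * enorm (x' - y'))%R]) ->
  (forall U : nat -> set 'rV[R]_p, E `<=` \bigcup_k U k -> E' `<=` \bigcup_k phi (U k)) ->
  hausdorff_measure t E' <= (c `^ t)%:E * hausdorff_measure t E.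
Proof.
move=> t0 c0 hphi cov; apply: ge_ereal_sup => _ [e e0 <-].
have -> : e = (c * (c^-1 * e))%R by rewrite mulVKf// gt_eqF.
apply: le_trans (hausdorff_content_lipschitz _ t0 c0 hphi cov) _.
rewrite lee_wpmul2l ?lee_fin ?powR_ge0// hausdorff_content_le// mulr_gt0//.
by rewrite invr_gt0.
Qed.

Lemma hausdorff_measure_dilation t (c : R) f E : (0 <= t)%R -> (0 < c)%R ->
  dilation c f -> hausdorff_measure t (f @` E) = (c `^ t)%:E * hausdorff_measure t E.
Proof.
move=> t0 c0 fc; apply/eqP; rewrite eq_le; apply/andP; split.
  apply: (hausdorff_measure_lipschitz (phi := fun U => f @` U)) => //.
    by move=> U _ _ [x Ux <-] [y Uy <-]; exists x, y; rewrite fc.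
  by move=> U EU _ [x /EU[k _ Ux] <-]; exists k => //; exists x.
rewrite -lee_pdivlMl ?powR_gt0//.
have -> : (c `^ t)^-1%R = (c^-1 `^ t)%R by rewrite -(powR_inv1 (ltW c0)) powRAC powR_inv1// powR_ge0.
apply: (hausdorff_measure_lipschitz (phi := preimage f)) => //.
- by rewrite invr_gt0.
- by move=> U x y Ux Uy; exists (f x), (f y); rewrite fc mulKf// gt_eqF.
- by move=> U EU x Ex; have [|k _ Uk] := EU (f x); [exists x|exists k].
Qed.

(** No set of small diameter meets both parts, so a cover by such sets splits into
  a cover of one part and a cover of the other. *)
Lemma hausdorff_measure_separated t (e : R) E E' : (0 <= t)%R -> (0 < e)%R ->
  (forall x y, E x -> E' y -> (e <= enorm (x - y))%R) ->
  hausdorff_measure t E + hausdorff_measure t E' <= hausdorff_measure t (E `|` E').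
Proof.
move=> t0 e0 sepE.
have h delta : (0 < delta < e)%R ->
    hausdorff_content t delta E + hausdorff_content t delta E' <=
    hausdorff_content t delta (E `|` E').
  move=> /andP[d0 de]; apply: le_ereal_inf_tmp => _ [U [cU dU] <-].
  pose V k := if `[< U k `&` E !=set0 >] then U k else set0.
  pose V' k := if `[< U k `&` E !=set0 >] then set0 else U k.
  have dset0 : ediam (set0 : set 'rV[R]_p) <= delta%:E.
    by apply: ge_ereal_sup => y [x [] ].
  have lV : hausdorff_content t delta E <= \sum_(0 <= k <oo) hausdorff_gauge t (V k).
    apply: ereal_inf_lbound; exists V => //; split=> [x Ex|k].
      have [k _ Ux] := cU _ (or_introl Ex); exists k => //.
      by rewrite /V; case: asboolP => // -[]; exists x.
    by rewrite /V; case: asboolP.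
  have lV' : hausdorff_content t delta E' <= \sum_(0 <= k <oo) hausdorff_gauge t (V' k).
    apply: ereal_inf_lbound; exists V' => //; split=> [y Ey|k].
      have [k _ Uy] := cU _ (or_intror Ey); exists k => //.
      rewrite /V'; case: asboolP => // -[x [Ux Ex]].
      have := le_trans (le_ediam Ux Uy) (dU k); rewrite lee_fin leNgt.
      by rewrite (lt_le_trans de)// sepE.
    by rewrite /V'; case: asboolP.
  apply: le_trans (leeD lV lV') _.
  rewrite -nneseriesD; [|by move=> *; exact: hausdorff_gauge_ge0..].
  apply: lee_nneseries => [k *|k _].
    by rewrite adde_ge0// hausdorff_gauge_ge0.
  by rewrite /V /V'; case: asboolP => _; rewrite hausdorff_gauge0 ?adde0 ?add0e.
have cle delta : (0 < delta)%R -> hausdorff_content t delta E + hausdorff_content t delta E' <=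
    hausdorff_measure t (E `|` E').
  move=> d0; pose d' := Num.min delta (e / 2)%R.
  have d'0 : (0 < d')%R by rewrite lt_min d0 divr_gt0.
  apply: (@le_trans _ _ (hausdorff_content t d' E + hausdorff_content t d' E')).
    by apply: leeD; apply: hausdorff_content_anti; rewrite ge_min lexx.
  apply: (@le_trans _ _ (hausdorff_content t d' (E `|` E'))); last exact: hausdorff_content_le.
  apply: h; rewrite d'0/= (@le_lt_trans _ _ (e / 2)%R)//.
    by rewrite ge_min lexx orbT.
  by rewrite ltr_pdivrMr// ltr_pMr// ltr1n.
have [H'oo|H'fin] := eqVneq (hausdorff_measure t E') +oo.
  suff HUoo : hausdorff_measure t (E `|` E') = +oo by rewrite HUoo leey.
  apply/eqP; rewrite -leye_eq -H'oo; apply: le_hausdorff_measure.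
  exact: subsetUr.
have H'f : hausdorff_measure t E' \is a fin_num.
  by rewrite ge0_fin_numE ?hausdorff_measure_ge0// ltey.
rewrite -leeBrDr//; apply: ge_ereal_sup => _ [d1 d10 <-].
have [Coo|Cfin] := eqVneq (hausdorff_content t d1 E) +oo.
  suff HUoo : hausdorff_measure t (E `|` E') = +oo by rewrite HUoo addye ?leey// eqe_oppLR.
  apply/eqP; rewrite -leye_eq -Coo; apply: le_trans (le_hausdorff_measure _ (@subsetUl _ E E')).
  exact: hausdorff_content_le.
have Cf : hausdorff_content t d1 E \is a fin_num.
  by rewrite ge0_fin_numE ?hausdorff_content_ge0// ltey.
rewrite leeBrDr// addeC -leeBrDr//; apply: ge_ereal_sup => _ [d2 d20 <-].
rewrite leeBrDr// addeC; pose d' := Num.min d1 d2.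
have d'0 : (0 < d')%R by rewrite lt_min d10.
apply: le_trans (cle _ d'0).
by apply: leeD; apply: hausdorff_content_anti; rewrite ge_min lexx// orbT.
Qed.

End hausdorff.

(** * Moran's equation *)

Section dimension.
Context {R : realType} {p : nat} {I : finType}.
Context (r : I -> R) (f : I -> 'rV[R]_p -> 'rV[R]_p) (A : set 'rV[R]_p).
Context (SA : separated_ifs r f A).
Lemma hausdorff_gauge_ifs_lty (t : R) : 0 <= t -> (hausdorff_gauge t A < +oo)%E.
Proof.
move=> t0; have [_ _ [[x Ax] cA] _ _] := SA; have [D D0 AD] := compact_ediam cA.
rewrite (hausdorff_gaugeE _ Ax); apply: poweR_lty.
exact: le_lt_trans (ediam_le AD) (ltry _).
Qed.

(** The cylinders of level [n] cover [A] and are small once [n] is large. *)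
Lemma hausdorff_content_ifs_le (t delta : R) : 0 <= t -> 0 < delta ->
  exists n0, forall n, (n0 <= n)%N -> (hausdorff_content t delta A <=
    ((\sum_i r i `^ t) ^+ n)%:E * hausdorff_gauge t A)%E.
Proof.
move=> t0 d0; have [_ _ [[x Ax] cA] _ _] := SA; have [D D0 AD] := compact_ediam cA.
have [n0 n0P] := word_ratio_small SA (divr_gt0 d0 D0).
have cyl w x1 y1 : cylinder f A w x1 -> cylinder f A w y1 -> exists x' y',
    [/\ A x', A y' & enorm (x1 - y1) <= word_ratio r w * enorm (x' - y')].
  by move=> [x' Ax' <-] [y' Ay' <-]; exists x', y'; rewrite (word_map_dilation SA).
exists n0 => n n0n.
apply: (@le_trans _ _ (\sum_(U <- map (cylinder f A) (words n)) hausdorff_gauge t U)%E).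
  apply: hausdorff_content_le_sum => [y Ay|_ /mapP[w + ->]].
    have [w wn wy] := words_cover SA n Ay; exists (cylinder f A w) => //=.
    by apply/mapP; exists w => //; rewrite mem_words wn.
  rewrite mem_words => /eqP wn.
  apply: (le_trans (ediam_lipschitz (word_ratio_gt0 SA w) (cyl w))).
  apply: (@le_trans _ _ ((delta / D)%:E * D%:E)%E).
    apply: lee_pmul; first by rewrite lee_fin ltW// (word_ratio_gt0 SA).
    - exact: ediam_ge0 Ax.
    - by rewrite lee_fin n0P// wn.
    - exact: ediam_le.
  by rewrite -EFinM divfK// gt_eqF.
rewrite big_map -(sum_words SA) -sumEFin ge0_sume_distrl => [|w _]; last by rewrite lee_fin powR_ge0.
apply: lee_sum => w _; apply: hausdorff_gauge_lipschitz => //; first exact: word_ratio_gt0 SA w.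
exact: cyl.
Qed.

Lemma hausdorff_measure_ifs0 (t : R) : 0 <= t -> \sum_i r i `^ t < 1 ->
  hausdorff_measure t A = 0%E.
Proof.
move=> t0 q1; apply/eqP; rewrite eq_le hausdorff_measure_ge0 andbT.
apply: ge_ereal_sup => _ [delta d0 <-].
have [n0 n0P] := hausdorff_content_ifs_le t0 d0.
set q := \sum_i _ in q1 n0P; have q0 : 0 <= q by apply: sumr_ge0 => i _; exact: powR_ge0.
have Gf : hausdorff_gauge t A \is a fin_num.
  by rewrite ge0_fin_numE ?hausdorff_gauge_ge0// hausdorff_gauge_ifs_lty.
apply/lee_addgt0Pr => e e0; rewrite add0e.
have : q ^+ n * fine (hausdorff_gauge t A) @[n --> \oo] --> 0 * fine (hausdorff_gauge t A).
  by apply: cvgMl; apply: cvg_expr; rewrite ger0_norm.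
rewrite mul0r => /cvgrPdist_le/(_ _ e0)[n _ nP].
have n0n := leq_maxl n0 n; apply: (le_trans (n0P _ n0n)).
have := nP _ (leq_maxr n0 n); rewrite /= sub0r normrN => /(le_trans (ler_norm _)).
by rewrite -lee_fin EFinM fineK.
Qed.

Lemma hausdorff_measure_ifs_lty (t : R) : 0 <= t -> \sum_i r i `^ t = 1 ->
  (hausdorff_measure t A < +oo)%E.
Proof.
move=> t0 q1; apply: le_lt_trans (hausdorff_gauge_ifs_lty t0).
apply: ge_ereal_sup => _ [delta d0 <-].
have [n0 /(_ _ (leqnn _))] := hausdorff_content_ifs_le t0 d0.
by rewrite q1 expr1n mul1e.
Qed.

(** Positivity of the content: each set of a cover is captured by a cylinder of
  comparable size, and the cylinders of a finite subcover have total mass at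
  least one. The terms [kappa / 2 ^+ k.+1] allow for covering sets that are
  too small, possibly points, to be comparable with any cylinder. *)
Lemma hausdorff_content_ifs_gt0 (t : R) : 0 < t -> \sum_i r i `^ t = 1 ->
  exists2 kappa : R, 0 < kappa &
    forall delta, (kappa%:E <= hausdorff_content t delta A)%E.
Proof.
move=> t0 q1; have [e e0 sepA] := ifs_separation SA.
pose kappa := e `^ t / 2; have k0 : 0 < kappa by rewrite divr_gt0// powR_gt0.
exists kappa => // delta; apply: le_ereal_inf_tmp => _ [U [cU dU] <-].
pose rho k := fine (ediam (U k)).
have rho_ge0 k : 0 <= rho k.
  have [[x Ux]|/nonemptyPn U0] := pselect (U k !=set0).
    exact/fine_ge0/(ediam_ge0 Ux).
  rewrite /rho U0 /ediam (_ : [set _ | _ in _ & _ in _] = set0) ?ereal_sup0//.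
  by rewrite -subset0 => z [x []].
have rhoP k x y : U k x -> U k y -> enorm (x - y) <= rho k.
  move=> Ux Uy; rewrite -lee_fin fineK ?le_ediam//.
  by rewrite ge0_fin_numE ?(ediam_ge0 Ux)// (le_lt_trans (dU k)) ?ltry.
have gaugeU k : hausdorff_gauge t (U k) = (rho k `^ t)%:E.
  have [[x Ux]|/nonemptyPn U0] := pselect (U k !=set0).
    rewrite (hausdorff_gaugeE _ Ux) -[X in (X `^ _)%E]fineK ?poweR_EFin//.
    by rewrite ge0_fin_numE ?(ediam_ge0 Ux)// (le_lt_trans (dU k)) ?ltry.
  rewrite U0 hausdorff_gauge0 /rho U0 /ediam (_ : [set _ | _ in _ & _ in _] = set0).
    by rewrite ereal_sup0/= powR0// gt_eqF.
  by rewrite -subset0 => z [x []].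
pose eps k := (kappa / 2 ^+ k.+1) `^ t^-1.
have eps0 k : 0 < eps k by rewrite powR_gt0// divr_gt0// exprn_gt0.
have /choice[W WP] k : exists w, U k `&` A `<=` cylinder f A w /\
    (e * word_ratio r w) `^ t <= rho k `^ t + kappa / 2 ^+ k.+1.
  have [w Uw wP] := cylinder_capture SA (divr_gt0 (eps0 k) e0) sepA (rhoP k).
  exists w; split => //.
  have -> : kappa / 2 ^+ k.+1 = eps k `^ t.
    by rewrite /eps -powRrM mulVf ?gt_eqF// powRr1// ltW// divr_gt0// exprn_gt0.
  have erw : 0 <= e * word_ratio r w by rewrite mulr_ge0 ?ltW ?(word_ratio_gt0 SA).
  case: wP => h.
    by rewrite ler_wpDr ?powR_ge0//; apply: ge0_ler_powR; rewrite ?nnegrE ?(ltW t0).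
  rewrite ler_wpDl ?powR_ge0//; apply: ge0_ler_powR; rewrite ?nnegrE ?(ltW t0) ?(ltW (eps0 k))//.
  by rewrite mulrC -ler_pdivlMr.
have [n An] : exists n, A `<=` \bigcup_(k < n) cylinder f A (W k).
  apply: (cylinder_finite_subcover SA) => x Ax; have [k _ Ux] := cU _ Ax.
  by exists k => //; apply: (WP k).1.
have : 1 <= \sum_(w <- map W (index_iota 0 n)) word_ratio r w `^ t.
  apply: (cylinder_cover_mass SA q1) => x /An[k kn xk].
  by exists (W k) => //=; apply: map_f; rewrite mem_index_iota.
rewrite big_map => mass.
have : e `^ t <= \sum_(0 <= k < n) (rho k `^ t + kappa / 2 ^+ k.+1).
  apply: (@le_trans _ _ (e `^ t * \sum_(0 <= k < n) word_ratio r (W k) `^ t)).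
    by rewrite ler_peMr ?powR_ge0.
  rewrite mulr_sumr; apply: ler_sum => k _.
  by rewrite -powRM ?(ltW e0) ?(ltW (word_ratio_gt0 SA _))//; exact: (WP k).2.
rewrite big_split/= -mulr_sumr => h.
have geo : \sum_(0 <= k < n) (2 ^+ k.+1)^-1 <= 1 :> R.
  have -> : \sum_(0 <= k < n) (2 ^+ k.+1)^-1 = 1 - (2 ^+ n)^-1 :> R.
    elim: (n) => [|m IHm]; first by rewrite big_geq// expr0 invr1 subrr.
    rewrite big_nat_recr//= IHm exprS.
    have : 2 ^+ m != 0 :> R by rewrite expf_neq0.
    by move=> ?; field.
  by rewrite gerBl invr_ge0 exprn_ge0.
have : kappa <= \sum_(0 <= k < n) rho k `^ t.
  have : kappa * \sum_(0 <= k < n) (2 ^+ k.+1)^-1 <= kappa by rewrite ler_piMr// ltW.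
  have : e `^ t = kappa + kappa by rewrite /kappa -splitr.
  by move: h; lra.
rewrite -lee_fin => /le_trans; apply.
under eq_eseriesr do rewrite gaugeU.
rewrite -sumEFin; apply: nneseries_lim_ge => k _ _.
by rewrite lee_fin powR_ge0.
Qed.

Lemma sum_powR_continuous : continuous (fun t : R => \sum_i r i `^ t).
Proof.
apply: (continuous_big (op := +%R)) => [|i _]; first exact: add_continuous.
have r0 : 0 < r i by case: SA => /(_ i)/andP[].
rewrite /powR gt_eqF// => t.
apply: (@continuous_comp _ _ _ (fun t : R => t * ln (r i)) (@expR R)); last exact: continuous_expR.
by apply: (@continuousM _ _ id (cst (ln (r i)))) => //; exact: cst_continuous.
Qed.

Lemma sum_powR_eq1 : (1 < #|I|)%N -> exists2 t : R, 0 < t & \sum_i r i `^ t = 1.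
Proof.
move=> I_gt1; have [c /andP[c0 c1] rc] := max_ratio SA.
have : #|I|%:R * c ^+ n @[n --> \oo] --> #|I|%:R * (0 : R).
  by apply: cvgMr; apply: cvg_expr; rewrite gtr0_norm.
rewrite mulr0 => /cvgrPdist_lt/(_ _ ltr01)[n _ /(_ n (leqnn n))]/=.
rewrite sub0r normrN => /(le_lt_trans (ler_norm _)) n1.
have q0 : \sum_i r i `^ 0 = #|I|%:R.
  by under eq_bigr do rewrite powRr0; rewrite sumr_const.
have qn : \sum_i r i `^ n%:R < 1.
  apply: le_lt_trans n1; rewrite mulr_natl -sumr_const; apply: ler_sum => i _.
  have ri : 0 <= r i by case: SA => /(_ i)/andP[/ltW].
  by rewrite powR_mulrn// lerXn2r// nnegrE ltW.
have q01 : 1 < \sum_i r i `^ 0 by rewrite q0 ltr1n.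
have [|||t] := @IVT R (fun t => \sum_i r i `^ t) 0 n%:R 1.
- exact: ler0n.
- exact/continuous_subspaceT/sum_powR_continuous.
- by rewrite min_r ?max_l ?ltW//= (lt_trans qn).
rewrite in_itv/= => /andP[t0 _] tq; exists t => //.
rewrite lt_neqAle t0 andbT; apply: contraTneq q01 => t0E.
by rewrite -t0E in tq; rewrite tq ltxx.
Qed.

Lemma sum_powR_decr (t u : R) : t < u -> \sum_i r i `^ u < \sum_i r i `^ t.
Proof.
move=> tu; apply: ltr_sum => [|i _].
  by have [_ _ [[x /(ifs_split SA)[i _]] _] _ _] := SA; apply/hasP; exists i; rewrite ?mem_index_enum.
have /andP[r0 r1] : 0 < r i < 1 by case: SA.
by rewrite /powR gt_eqF// ltr_expR ltr_nM2r// ln_lt0// r0.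
Qed.

(** Let [t] solve Moran's equation. Above [t] the covers by the cylinders of one
  level show that the measure vanishes. Below [t] it cannot vanish: on sets of
  diameter at most one a smaller exponent gives a larger gauge, and the content
  with exponent [t] is positive. *)
Lemma hausdorff_dim_ifs (d : R) : (1 < #|I|)%N -> hausdorff_dim A = d%:E ->
  0 < d /\ \sum_i r i `^ d = 1.
Proof.
move=> I_gt1 dimA; have [t t0 t1] := sum_powR_eq1 I_gt1; suff -> : d = t by [].
have [kappa k0 kP] := hausdorff_content_ifs_gt0 t0 t1.
apply/eqP; rewrite -eqe -dimA eq_le; apply/andP; split.
  apply/lee_addgt0Pr => e e0; apply: ereal_inf_lbound.
  exists (t + e) => //; split; first by rewrite ltW// addr_gt0.
  apply: hausdorff_measure_ifs0; first by rewrite ltW// addr_gt0.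
  by rewrite -t1; apply: sum_powR_decr; rewrite ltrDl.
apply: le_ereal_inf_tmp => _ [u [u0 Hu] <-]; rewrite lee_fin leNgt; apply/negP => ut.
have : (hausdorff_content t 1 A <= hausdorff_content u 1 A)%E.
  apply: le_ereal_inf_tmp => _ [U [cU dU] <-].
  apply: (@le_trans _ _ (\sum_(0 <= k <oo) hausdorff_gauge t (U k))%E).
    by apply: ereal_inf_lbound; exists U.
  apply: lee_nneseries => k *; first exact: hausdorff_gauge_ge0.
  have [[x Ux]|/nonemptyPn ->] := pselect (U k !=set0); last by rewrite !hausdorff_gauge0.
  rewrite !(hausdorff_gaugeE _ Ux); have := ediam_ge0 Ux; have := dU k.
  case: (ediam (U k)) => //= a; rewrite !lee_fin => a1 a0.
  move: a0; rewrite le_eqVlt => /predU1P[<-|a0].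
    by rewrite powR0 ?gt_eqF// powR_ge0.
  by apply: ger_powR; [exact/andP|exact: ltW].
have Cu0 : (hausdorff_content u 1 A <= 0)%E.
  by rewrite -Hu; apply: hausdorff_content_le; exact: ltr01.
move=> /le_trans/(_ Cu0)/(le_trans (kP 1)).
by rewrite lee_fin leNgt k0.
Qed.

End dimension.

(** * Hausdorff measure on the Borel sets *)

Section hausdorff_trace.
Context {R : realType} {p : nat}.
Context (t : R) (A : set 'rV[R]_p).
Local Open Scope ereal_scope.

(** With this outer measure, the Caratheodory condition for a set depends only on
  the part of the set inside [A]. *)
Definition hausdorff_trace (E : set 'rV[R]_p) : \bar R := hausdorff_measure t (E `&` A).

Let trace0 : hausdorff_trace set0 = 0.
Proof. by rewrite /hausdorff_trace set0I hausdorff_measure0. Qed.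

Let trace_ge0 E : 0 <= hausdorff_trace E.
Proof. exact: hausdorff_measure_ge0. Qed.

Let le_trace : {homo hausdorff_trace : E F / E `<=` F >-> E <= F}.
Proof. by move=> E F EF; apply: le_hausdorff_measure; exact: setSI. Qed.

Let trace_sigma_subadditive : sigma_subadditive hausdorff_trace.
Proof.
by move=> F; rewrite /hausdorff_trace setI_bigcupl; exact: hausdorff_measure_sigma_subadditive.
Qed.

HB.instance Definition _ := isOuterMeasure.Build R _ hausdorff_trace
  trace0 trace_ge0 le_trace trace_sigma_subadditive.

End hausdorff_trace.

Section ifs_measure.
Context {R : realType} {p : nat} {I : finType}.
Context (r : I -> R) (f : I -> 'rV[R]_p -> 'rV[R]_p) (A : set 'rV[R]_p).
Context (SA : separated_ifs r f A).
Context (t : R).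
Context (t_ge0 : 0 <= t).

(** A cylinder and the rest of [A] are disjoint compact sets, hence at positive
  distance. *)
Lemma cylinder_caratheodory w : (hausdorff_trace t A).-caratheodory (cylinder f A w).
Proof.
apply: le_caratheodory_measurable => X; rewrite /hausdorff_trace.
have [|e e0 he] := compact_separated (@compact_cylinder _ _ _ _ _ _ SA w)
  (@compact_setD_cylinder _ _ _ _ _ _ SA w).
  by rewrite setIC setDE -setIA setICl setI0.
apply: (@le_trans _ _ (hausdorff_measure t
    ((X `&` cylinder f A w `&` A) `|` (X `&` ~` cylinder f A w `&` A)))).
  apply: (hausdorff_measure_separated t_ge0 e0) => x y [[_ wx] _] [[_ wy] Ay].
  exact: he.
apply: le_hausdorff_measure => x.
by case=> -[[Xx _] Ax]; split.
Qed.

Lemma cylinder_nbhs (x : 'rV[R]_p) (G : set 'rV[R]_p) : A x -> nbhs x G ->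
  exists2 w, cylinder f A w x & cylinder f A w `<=` G.
Proof.
move=> Ax /nbhs_ballP[e /= e0 eG]; have [_ _ [_ cA] _ _] := SA.
have [D D0 AD] := compact_ediam cA.
have [n nP] := word_ratio_small SA (divr_gt0 (divr_gt0 e0 (ltr0Sn _ 1)) D0).
have [w wn wx] := words_cover SA n Ax; exists w => // y wy; apply: eG.
rewrite mx_norm_ball /ball_/=; apply: le_lt_trans (mx_norm_le_enorm _) _.
case: wx wy => x' Ax' <- [y' Ay' <-]; rewrite (word_map_dilation SA).
apply: (@le_lt_trans _ _ (e / 2 / D * D)).
  by apply: ler_pM; rewrite ?enorm_ge0 ?AD ?(ltW (word_ratio_gt0 SA _)) ?nP ?wn.
by rewrite divfK ?gt_eqF// ltr_pdivrMr// ltr_pMr// ltr1n.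
Qed.

(** An open set meets [A] in a countable union of cylinders. *)
Lemma borel_caratheodory (B : set (@borel R p)) : measurable B ->
  (hausdorff_trace t A).-caratheodory B.
Proof.
move: B; apply: smallest_sub; first split.
- exact: caratheodory_measurable_set0.
- by move=> B cB; rewrite setTD; exact: caratheodory_measurable_setC.
- exact: caratheodory_measurable_bigcup.
move=> G oG.
pose F k := if @unpickle (seq I) k is Some w then
  if `[< cylinder f A w `<=` G >] then cylinder f A w else set0 else set0.
have cF : (hausdorff_trace t A).-caratheodory (\bigcup_k F k).
  apply: caratheodory_measurable_bigcup => k; rewrite /F.
  case: unpickle => [w|]; last exact: caratheodory_measurable_set0.
  case: ifP => _; last exact: caratheodory_measurable_set0.
  exact: cylinder_caratheodory.
have FG : (\bigcup_k F k) `&` A = G `&` A.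
  apply/seteqP; split=> x [].
    move=> [k _]; rewrite /F; case: unpickle => // w.
    by case: asboolP => // wG wx Ax; split => //; exact: wG.
  move=> Gx Ax; split => //.
  have [w wx wG] := cylinder_nbhs Ax (open_nbhs_nbhs (conj oG Gx)).
  by exists (pickle w) => //; rewrite /F pickleK asboolT.
move=> X; have := cF X; rewrite /hausdorff_trace.
rewrite -!setIA FG (setIC _ A) (setIC (~` \bigcup_k F k)) -!setDE.
have -> : A `\` \bigcup_k F k = A `\` ((\bigcup_k F k) `&` A).
  by rewrite setDIr setDv setU0.
by rewrite FG setDIr setDv setU0 !setDE (setIC A (~` G)).
Qed.

Lemma cylinder_measurable w : measurable (cylinder f A w : set (@borel R p)).
Proof.
rewrite -[cylinder f A w]setCK; apply: measurableC; apply: sub_gen_smallest.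
apply: closed_openC; apply: compact_closed; first exact: norm_hausdorff.
exact: compact_cylinder SA w.
Qed.

Let trace_semi_sigma_additive :
  semi_sigma_additive (hausdorff_trace t A : set (@borel R p) -> \bar R).
Proof.
move=> F mF tF mUF.
apply: (@caratheodory_measure_sigma_additive _ _ (hausdorff_trace t A)) => //.
  by move=> k; exact: borel_caratheodory.
exact: borel_caratheodory.
Qed.

Let trace0 : hausdorff_trace t A (set0 : set (@borel R p)) = 0%E.
Proof. exact: outer_measure0. Qed.

Let trace_ge0 (B : set (@borel R p)) : (0 <= hausdorff_trace t A B)%E.
Proof. exact: outer_measure_ge0. Qed.

(** The normalized Hausdorff measure is the self-similar measure, by the scaling
  property of Hausdorff measure. *)
Lemma normalized_hausdorff_ifs :
  (0 < hausdorff_measure t A < +oo)%E ->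
  exists2 m : {measure set (@borel R p) -> \bar R},
    normalized_hausdorff t A = m &
    forall w, m (cylinder f A w) = (word_ratio r w `^ t)%:E.
Proof.
move=> /andP[H0 Hoo].
have Hf : hausdorff_measure t A \is a fin_num by rewrite ge0_fin_numE ?ltW.
have h0 : 0 < fine (hausdorff_measure t A) by rewrite fine_gt0// H0.
have hi0 : 0 <= (fine (hausdorff_measure t A))^-1 by rewrite invr_ge0 ltW.
pose m0 : {measure set (@borel R p) -> \bar R} :=
  HB.pack (hausdorff_trace t A : set (@borel R p) -> \bar R)
   (isMeasure.Build _ (@borel R p) R (hausdorff_trace t A : set (@borel R p) -> \bar R)
      trace0 trace_ge0 trace_semi_sigma_additive).
have mE : normalized_hausdorff t A = mscale (NngNum hi0) m0.
  apply/funext => B; rewrite /normalized_hausdorff /mscale/= muleC.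
  rewrite -[in LHS](fineK Hf) inver gt_eqF//.
exists (mscale (NngNum hi0) m0) => // w.
apply: (etrans (esym (congr1 (@^~ (cylinder f A w)) mE))).
transitivity (hausdorff_measure t (cylinder f A w) / hausdorff_measure t A)%E.
  congr (hausdorff_measure t _ / _)%E; apply/setIidPl.
  exact: cylinder_sub SA w.
rewrite (hausdorff_measure_dilation _ t_ge0 (word_ratio_gt0 SA w) (word_map_dilation SA w)).
by rewrite -muleA divee ?mule1// gt_eqF.
Qed.

End ifs_measure.

(** * Weak convergence from the frequencies of cylinders *)

Section empirical.
Context {R : realType} {p : nat}.

Lemma empirical_measureE N (x : 'I_N -> @borel R p) B :
  empirical_measure x B = (N%:R^-1 * \sum_(i < N) (x i \in B)%:R)%:E.
Proof.
by rewrite /empirical_measure EFinM -sumEFin.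
Qed.

Lemma empirical_measure_is_measure N (x : 'I_N -> @borel R p) :
  exists m : {measure set (@borel R p) -> \bar R}, empirical_measure x = m.
Proof.
have N0 : 0 <= N%:R^-1 :> R by rewrite invr_ge0.
pose y (k : nat) : {measure set (@borel R p) -> \bar R} :=
  if insub k is Some i then dirac (x i) else mzero.
exists (mscale (NngNum N0) (msum y N)); apply/funext => B.
rewrite /empirical_measure /mscale/= /msum; congr (_ * _)%E.
apply: eq_bigr => i _; rewrite /y; case: insubP => [j _ ji|]; last by rewrite ltn_ord.
by have -> : j = i by exact: val_inj.
Qed.

End empirical.

Section weak_convergence.
Context {R : realType} {p : nat} {I : finType}.
Context (r : I -> R) (f : I -> 'rV[R]_p -> 'rV[R]_p) (A : set 'rV[R]_p).
Context (SA : separated_ifs r f A).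

Local Notation cyl := (cylinder f A).

Lemma cylinder_nested u w x : cyl u x -> cyl w x -> (size u <= size w)%N -> cyl w `<=` cyl u.
Proof.
move=> [y Ay yx] [z Az zx] uw; rewrite -(cat_take_drop (size u) w).
have -> : take (size u) w = u.
  apply: (word_map_eq SA (y := y) (x := word_map f (drop (size u) w) z)) => //.
  - by rewrite size_takel.
  - exact: word_map_sub SA _ _ Az.
  - by rewrite -word_map_cat cat_take_drop zx yx.
exact: cylinder_cat_sub SA _ _.
Qed.

Lemma words_trivIset n : trivIset [set` @words I n] cyl.
Proof.
apply/trivIsetP => u v /=; rewrite !mem_words => /eqP un /eqP vn uv.
rewrite -subset0 => x [[y Ay <-] [z Az]] /esym/(word_map_eq SA) uvE.
by move: uv; rewrite uvE ?eqxx// un vn.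
Qed.

Lemma words_bigsetU n : \big[setU/set0]_(w <- words n) cyl w = A.
Proof.
rewrite -bigcup_seq; apply/seteqP; split=> [x [w _]|x Ax]; first exact: cylinder_sub SA w x.
by have [w wn wx] := words_cover SA n Ax; exists w => //=; rewrite mem_words wn.
Qed.

(** Heine's theorem for cylinders: those on which [g] varies by at most [e] cover
  [A]; finitely many of them suffice, and each cylinder of their maximal level
  lies in one of them. *)
Lemma cylinder_oscillation (g : 'rV[R]_p -> R) (e : R) : 0 < e -> {within A, continuous g} ->
  exists n, forall w x y, size w = n -> cyl w x -> cyl w y -> `|g x - g y| <= e.
Proof.
move=> e0 cg.
pose good w := forall x y, cyl w x -> cyl w y -> `|g x - g y| <= e.
have goodP x : A x -> exists2 w, cyl w x & good w.
  move=> Ax.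
  have : nbhs x [set y | A y -> `|g x - g y| <= e / 2].
    have /cvgrPdist_le/(_ (e / 2)) := (subspace_continuousP _ _).1 cg x Ax.
    by rewrite divr_gt0// => /(_ isT).
  move=> /(cylinder_nbhs SA Ax)[w wx wG]; exists w => // y z wy wz.
  have Ay := cylinder_sub SA wy; have Az := cylinder_sub SA wz.
  have := wG _ wy Ay; have := wG _ wz Az => h1 h2.
  rewrite (_ : g y - g z = (g x - g z) - (g x - g y)); last by ring.
  by apply: le_trans (ler_normB _ _) _; rewrite [leRHS]splitr lerD.
have [_ _ [[x0 Ax0] _] _ _] := SA; have [w0 _ gw0] := goodP _ Ax0.
pose W k := if @unpickle (seq I) k is Some w then (if `[< good w >] then w else w0) else w0.
have gW k : good (W k).
  by rewrite /W; case: unpickle => // w; case: asboolP.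
have [n An] : exists n, A `<=` \bigcup_(k < n) cyl (W k).
  apply: (cylinder_finite_subcover SA) => x /goodP[w wx gw].
  by exists (pickle w) => //; rewrite /W pickleK asboolT.
exists (\max_(k < n) size (W k)) => w x y wn wx wy.
have [k /= kn kx] := An _ (cylinder_sub SA wx).
have wk : cyl w `<=` cyl (W k).
  apply: cylinder_nested kx wx _.
  by rewrite wn (@leq_bigmax _ (fun k : 'I_n => size (W k)) (Ordinal kn)).
by apply: (gW k); exact: wk.
Qed.

Let mA : measurable (A : set (@borel R p)).
Proof. by have := cylinder_measurable SA [::]; rewrite cylinder_nil. Qed.

Lemma within_continuous_borel_measurable (g : 'rV[R]_p -> R) : {within A, continuous g} ->
  measurable_fun (A : set (@borel R p)) (g : @borel R p -> R).
Proof.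
move=> /continuousP cg; apply: (measurability _ (RGenOpens.measurableE R)).
move=> _ [_ [a [b ->] <-]].
have oab : open (`]a, b[%classic : set R) by exact: interval_open.
have /open_subspaceP[V oV VA] := cg _ oab.
rewrite setIC -VA; apply: measurableI => //.
exact: sub_gen_smallest.
Qed.

(** Riemann sums over cylinders, for an arbitrary measure: they serve to compare
  the empirical measures with the normalized Hausdorff measure. *)
Lemma integral_cylinders (m : {measure set (@borel R p) -> \bar R}) (g : 'rV[R]_p -> R)
    (n : nat) (a c : seq I -> R) (e : R) : {within A, continuous g} ->
  (forall w, m (cyl w) = (a w)%:E) ->
  (forall w x, size w = n -> cyl w x -> `|g x - c w| <= e) ->
  exists2 J : R, (\int[m]_(x in (A : set (@borel R p))) (g x)%:E)%E = J%:E &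
    `|J - \sum_(w <- words n) a w * c w| <= e * \sum_(w <- words n) a w.
Proof.
move=> cg ma gc; have mg := within_continuous_borel_measurable cg.
have mcyl w : measurable (cyl w : set (@borel R p)) by exact: cylinder_measurable SA w.
have /choice[Jw JwP] w : exists J : R, size w = n ->
    (\int[m]_(x in (cyl w : set (@borel R p))) (g x)%:E)%E = J%:E /\
    `|J - a w * c w| <= e * a w.
  have [wn|wn] := pselect (size w = n); last by exists 0.
  have mlty : (m (cyl w) < +oo)%E by rewrite ma ltry.
  have intcst k : m.-integrable (cyl w : set (@borel R p)) (EFin \o cst k).
    apply: measurable_bounded_integrable => //.
    exists `|k|; split => // M kM x _; exact: ltW.
  have intg : m.-integrable (cyl w : set (@borel R p)) (EFin \o g).
    apply: measurable_bounded_integrable => //.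
      by apply: measurable_funS mg => //; exact: cylinder_sub SA w.
    exists (`|c w| + e); split=> [|M kM x wx]; first exact: num_real.
    apply: le_trans (ltW kM).
    rewrite -[g x](subrK (c w)) addrC; apply: le_trans (ler_normD _ _) _.
    by rewrite lerD2l gc.
  have cste k : (\int[m]_(x in (cyl w : set (@borel R p))) (EFin \o cst k) x)%E = (k * a w)%:E.
    rewrite (_ : EFin \o cst k = cst k%:E)//.
    by rewrite integral_cst// EFinM; congr (_ * _)%E; exact: ma.
  have gf := integrable_fin_num (mcyl w) intg.
  exists (fine (\int[m]_(x in (cyl w : set (@borel R p))) (g x)%:E)) => _.
  rewrite fineK//; split => //.
  have lo : ((c w - e) * a w <= fine (\int[m]_(x in (cyl w : set (@borel R p))) (g x)%:E)).
    rewrite -lee_fin fineK// -cste; apply: le_integral => // x; rewrite inE => wx.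
    by rewrite lee_fin/=; have := gc _ _ wn wx; rewrite ler_norml => /andP[]; lra.
  have hi : fine (\int[m]_(x in (cyl w : set (@borel R p))) (g x)%:E) <= ((c w + e) * a w).
    rewrite -lee_fin fineK// -cste; apply: le_integral => // x; rewrite inE => wx.
    by rewrite lee_fin/=; have := gc _ _ wn wx; rewrite ler_norml => /andP[]; lra.
  by rewrite ler_norml; apply/andP; split; lra.
exists (\sum_(w <- words n) Jw w).
  rewrite -[in LHS](words_bigsetU n) integral_bigsetU_EFin//.
  - rewrite -sumEFin; apply: eq_big_seq => w; rewrite mem_words => /eqP wn.
    exact: (JwP w wn).1.
  - exact: uniq_words.
  - exact: words_trivIset.
  - by apply/measurable_EFinP; rewrite words_bigsetU.
rewrite -sumrB mulr_sumr; apply: le_trans (ler_norm_sum _ _ _) _.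
rewrite big_seq [leRHS]big_seq; apply: ler_sum => w; rewrite mem_words => /eqP wn.
exact: (JwP w wn).2.
Qed.

(** On the cylinders of a deep level the test function is almost constant, so its
  integrals are close to sums over these cylinders, and for the sums the
  convergence is assumed. *)
Lemma weak_star_cvg_cylinders (t : R) (F : set_system nat) (x : forall N, 'I_N -> 'rV[R]_p) :
  Filter F -> 0 <= t -> (0 < hausdorff_measure t A < +oo)%E -> \sum_i r i `^ t = 1 ->
  (forall w, N%:R^-1 * \sum_(i < N) (x N i \in cyl w)%:R @[N --> F] --> word_ratio r w `^ t) ->
  weak_star_cvg A F (fun N => empirical_measure (x N)) (normalized_hausdorff t A).
Proof.
move=> FF t0 HA r1 cvgx g cg.
have [m mE mcyl] := normalized_hausdorff_ifs SA t0 HA.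
pose a N w := N%:R^-1 * \sum_(i < N) (x N i \in cyl w)%:R : R.
have [_ _ [[x0 Ax0] _] _ _] := SA.
have c_in w : cyl w (word_map f w x0) by exists x0.
have [J JE _] : exists2 J : R, (\int[m]_(x in (A : set (@borel R p))) (g x)%:E)%E = J%:E & True.
  have [n nP] := cylinder_oscillation ltr01 cg.
  have [|J JE _] := @integral_cylinders m g n (fun w => word_ratio r w `^ t)
    (fun w => g (word_map f w x0)) 1 cg mcyl; last by exists J.
  by move=> w y wn wy; apply: nP wn wy (c_in w).
have /choice[JN JNE] N : exists J, (\int[empirical_measure (x N)]_(x in (A : set (@borel R p))) (g x)%:E)%E = J%:E.
  have [n nP] := cylinder_oscillation ltr01 cg.
  have [nu nuE] := empirical_measure_is_measure (x N); rewrite nuE.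
  have [||K KE _] := @integral_cylinders nu g n (a N)
    (fun w => g (word_map f w x0)) 1 cg; last by exists K.
  - by move=> w; rewrite -empirical_measureE nuE.
  - by move=> w y wn wy; apply: nP wn wy (c_in w).
rewrite mE JE; under eq_fun do rewrite JNE.
apply: cvg_EFin; first exact: nearW.
apply/cvgrPdist_le => e e0 /=.
have e4 : 0 < e / 4 by rewrite divr_gt0.
have [n nP] := cylinder_oscillation e4 cg.
pose c w := g (word_map f w x0).
have gc w y : size w = n -> cyl w y -> `|g y - c w| <= e / 4.
  by move=> wn wy; apply: nP wn wy (c_in w).
have cvg1 : \sum_(w <- words n) a N w @[N --> F] --> (1 : R).
  rewrite -[X in _ --> X](expr1n _ n) -[in X in _ --> X]r1 -(sum_words SA).
  apply: (cvg_big (op := +%R)) => [|w _]; first exact: add_continuous.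
  exact: cvgx.
have cvg2 : \sum_(w <- words n) a N w * c w @[N --> F] -->
    \sum_(w <- words n) word_ratio r w `^ t * c w.
  apply: (cvg_big (op := +%R)) => [|w _]; first exact: add_continuous.
  by apply: cvgMl; exact: cvgx.
move/cvgrPdist_le/(_ _ ltr01): cvg1; move/cvgrPdist_le/(_ _ e4): cvg2.
apply: filterS2 => N h2 h1.
have [J' J'E hJ] := integral_cylinders cg mcyl gc.
have [nu nuE] := empirical_measure_is_measure (x N).
have nucyl w : nu (cyl w) = (a N w)%:E by rewrite -empirical_measureE nuE.
have [K KE hK] := integral_cylinders cg nucyl gc.
have {}J'E : J' = J by apply: EFin_inj; rewrite -J'E.
have {}KE : K = JN N by apply: EFin_inj; rewrite -KE -JNE nuE.
rewrite (sum_words SA) r1 expr1n mulr1 J'E in hJ.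
rewrite KE in hK.
set S1 := \sum_(w <- _) _ in hJ h2; set S2 := \sum_(w <- _) _ in hK h2.
set T := \sum_(w <- _) _ in hK h1.
have hT : e / 4 * T <= e / 2.
  move: h1; rewrite ler_norml => /andP[h1 _].
  have : T <= 2 by lra.
  by move=> /(ler_wpM2l (ltW e4)); lra.
rewrite (_ : J - JN N = (J - S1) + (S1 - S2) + (S2 - JN N)); last by ring.
rewrite distrC in hK.
apply: le_trans (ler_normD _ _) _.
have := ler_normD (J - S1) (S1 - S2); lra.
Qed.

End weak_convergence.

(** * Riesz energy of lists of points *)

Section energy.
Context {R : realType} {p : nat}.
Context (s : R).
Context (s_gt0 : 0 < s).
Implicit Types (x y : 'rV[R]_p) (xs ys : seq 'rV[R]_p) (A : set 'rV[R]_p).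

Definition riesz_kernel x y : R := enorm (x - y) `^ (- s).

(** Lists turn restriction and union of configurations into filtering and
  concatenation. The diagonal terms may stay in the sum: they are zero because
  [0 `^ (- s) = 0]. *)
Definition seq_energy xs : R := \sum_(x <- xs) \sum_(y <- xs) riesz_kernel x y.

Definition points_of A xs : Prop := uniq xs /\ forall x, x \in xs -> A x.

Lemma riesz_kernel_ge0 x y : 0 <= riesz_kernel x y.
Proof. exact: powR_ge0. Qed.

Lemma riesz_kernel_le x y (e : R) : 0 < e -> e <= enorm (x - y) ->
  riesz_kernel x y <= e `^ (- s).
Proof.
move=> e0 exy; rewrite /riesz_kernel !powRN lef_pV2 ?posrE ?powR_gt0//; last exact: lt_le_trans exy.
by rewrite ge0_ler_powR// ?nnegrE ?enorm_ge0 ?(ltW e0) ?(ltW s_gt0).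
Qed.

Lemma riesz_kernel_ge x y (e : R) : x != y -> enorm (x - y) <= e ->
  e `^ (- s) <= riesz_kernel x y.
Proof.
move=> /enorm_gt0 xy exy; have e0 := lt_le_trans xy exy.
rewrite /riesz_kernel !powRN lef_pV2 ?posrE ?powR_gt0//.
by rewrite ge0_ler_powR// ?nnegrE ?enorm_ge0 ?(ltW e0) ?(ltW s_gt0).
Qed.

Lemma seq_energy_ge0 xs : 0 <= seq_energy xs.
Proof. by do 2!(apply: sumr_ge0 => ? _); exact: powR_ge0. Qed.

Lemma riesz_energyE N (x : 'I_N -> 'rV[R]_p) :
  riesz_energy s x = seq_energy [seq x i | i <- enum 'I_N].
Proof.
rewrite /seq_energy big_map big_enum; apply: eq_bigr => i _.
rewrite big_map big_enum [RHS](bigD1 i)//= /riesz_kernel subrr enorm0.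
by rewrite powR0 ?add0r// oppr_eq0 gt_eqF.
Qed.

Lemma riesz_energy_nth xs :
  riesz_energy s (fun i : 'I_(size xs) => nth 0 xs i) = seq_energy xs.
Proof.
rewrite riesz_energyE; congr seq_energy.
by rewrite (map_comp (nth 0 xs) val) val_enum_ord -/(mkseq _ _) mkseq_nth.
Qed.

Lemma configuration_points A N (x : 'I_N -> 'rV[R]_p) : configuration A x ->
  points_of A [seq x i | i <- enum 'I_N].
Proof.
move=> [xinj xA]; split; first by rewrite map_inj_uniq ?enum_uniq.
by move=> _ /mapP[i _ ->].
Qed.

Lemma points_configuration A xs : points_of A xs ->
  configuration A (fun i : 'I_(size xs) => nth 0 xs i).
Proof.
move=> [uxs xsA]; split=> [i j /eqP|i]; last exact/xsA/mem_nth.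
by rewrite nth_uniq// => /eqP/val_inj.
Qed.

Lemma seq_energy_map (c : R) f xs : 0 < c -> dilation c f ->
  seq_energy (map f xs) = c `^ (- s) * seq_energy xs.
Proof.
move=> c0 fc; rewrite /seq_energy big_map mulr_sumr; apply: eq_bigr => x _.
rewrite big_map mulr_sumr; apply: eq_bigr => y _.
by rewrite /riesz_kernel fc powRM// ?enorm_ge0// ltW.
Qed.

(** The interactions between different blocks are nonnegative. *)
Lemma seq_energy_blocks (J : eqType) (L : seq J) (P : J -> pred 'rV[R]_p) xs : uniq L ->
  (forall i j x, i \in L -> j \in L -> P i x -> P j x -> i = j) ->
  \sum_(i <- L) seq_energy ([seq x <- xs | P i x]) <= seq_energy xs.
Proof.
move=> uL PL; under eq_bigr do rewrite /seq_energy big_filter big_mkcond.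
rewrite exchange_big/=; apply: ler_sum => x _.
rewrite -big_mkcond/=; under eq_bigr do rewrite big_filter big_mkcond.
rewrite exchange_big/=; apply: ler_sum => y _.
rewrite -big_mkcondr/=.
have [[i /andP[iL /andP[Pix Piy]]]|h] :=
    pselect (exists i, [&& i \in L, P i x & P i y]); last first.
  rewrite big_seq_cond big1 ?riesz_kernel_ge0// => i iP; exfalso; apply: h.
  by exists i.
rewrite big_mkcond (bigD1_seq i)//= Pix Piy/= big_seq_cond big1 ?addr0//.
move=> j /andP[jL ji]; case: ifP => // /andP[Pjx _].
by move: ji; rewrite (PL _ _ _ jL iL Pjx Pix) eqxx.
Qed.

End energy.

(** * Energies of order [N `^ (1 + s / d)] *)

Section energy_bounds.
Context {R : realType} {p : nat} {I : finType}.
Context (r : I -> R) (f : I -> 'rV[R]_p -> 'rV[R]_p) (A : set 'rV[R]_p).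
Context (SA : separated_ifs r f A).
Context (s d : R).
Context (d_gt0 : 0 < d).
Context (d_lt_s : d < s).
Context (moran : \sum_i r i `^ d = 1).

Let s_gt0 : 0 < s. Proof. exact: lt_trans d_lt_s. Qed.
Let r_gt0 i : 0 < r i. Proof. by case: SA => /(_ i)/andP[]. Qed.

Lemma min_ratio : exists2 rho : R, 0 < rho < 1 & forall i, rho <= r i.
Proof.
exists (\big[Num.min/2^-1]_i r i); last by move=> i; exact: bigmin_le_cond.
apply/andP; split; first by apply: lt_bigmin => //; rewrite invr_gt0.
by apply: (@le_lt_trans _ _ 2^-1); [exact: bigmin_le_id|rewrite invf_lt1// ltr1n].
Qed.

(** Induction on scales: every scale below [1] is reached from the scales in
  [[1, rho^-1]] by finitely many multiplications by contraction ratios. *)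
Lemma scale_ind (rho : R) (P : R -> Prop) : 0 < rho -> (forall i, rho <= r i) ->
  (forall delta, 1 <= delta <= rho^-1 -> P delta) ->
  (forall delta, 0 < delta < 1 -> (forall i, P (delta / r i)) -> P delta) ->
  forall delta, 0 < delta <= rho^-1 -> P delta.
Proof.
move=> rho0 rhor P1 PS delta /andP[d0 d1]; have [c /andP[c0 c1] rc] := max_ratio SA.
have : c ^+ n @[n --> \oo] --> 0 by apply: cvg_expr; rewrite gtr0_norm.
move=> /cvgrPdist_le/(_ _ d0)[n _ /(_ _ (leqnn n))].
rewrite sub0r normrN ger0_norm ?exprn_ge0 ?(ltW c0)//.
elim: n delta d0 d1 => [|n IHn] delta d0 d1 cd.
  by apply: P1; rewrite d1 andbT -(expr0 c).
have [h|h] := leP 1 delta; first by apply: P1; rewrite h.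
apply: PS => [|i]; first by rewrite d0.
apply: IHn; first by rewrite divr_gt0.
  by rewrite ler_pdivrMr// (le_trans (ltW h))// ler_pdivlMl ?mulr1.
by rewrite ler_pdivlMr// (le_trans _ cd)// exprSr ler_wpM2l ?exprn_ge0 ?(ltW c0)//.
Qed.

Lemma powR_scale (a t delta : R) i : 0 < delta ->
  r i `^ a * (delta / r i) `^ (- t) = r i `^ (a + t) * delta `^ (- t).
Proof.
move=> d0; have ri := r_gt0 i.
rewrite powRM ?(ltW d0) ?invr_ge0 ?(ltW ri)// -powR_inv1 ?(ltW ri)// -powRrM mulN1r opprK.
by rewrite powRD ?(gt_eqF ri) ?implybT// mulrA mulrAC.
Qed.

(** Take on every branch the first word of ratio at most [delta]. The bound on
  the cardinality passes from the scales [delta / r i] to [delta] by Moran's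
  equation. *)
Lemma stopping_words (rho delta : R) : 0 < rho -> (forall i, rho <= r i) ->
  0 < delta <= rho^-1 ->
  exists L : seq (seq I), [/\ A `<=` \bigcup_(w in [set` L]) cylinder f A w,
    forall w, w \in L -> word_ratio r w <= delta &
    (size L)%:R <= rho `^ (- d) * delta `^ (- d)].
Proof.
move=> rho0 rhor; move: delta; apply: scale_ind => // delta.
  move=> /andP[d1 drho]; have d0 := lt_le_trans ltr01 d1.
  exists [:: [::]]; split=> [x Ax|w|].
  - by exists [::]; rewrite /= ?inE// cylinder_nil.
  - by rewrite inE => /eqP ->; rewrite word_ratio_nil.
  rewrite -powRM ?(ltW d0) ?(ltW rho0)// powRN invf_ge1 ?powR_gt0 ?mulr_gt0//.
  rewrite -[leRHS](congr1 (@^~ d) (@powR1 R)) ge0_ler_powR ?nnegrE ?mulr_ge0 ?(ltW d0) ?(ltW d_gt0) ?(ltW rho0)//.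
  by rewrite mulrC -ler_pdivlMr// mul1r.
move=> /andP[d0 d1] /choice[Lf LP].
exists [seq i :: w | i <- enum I, w <- Lf i]; split.
- move=> x /(ifs_split SA)[i [y Ay <-]]; have [cov _ _] := LP i.
  have [w wL wy] := cov _ Ay; exists (i :: w); last by rewrite cylinder_cons; exists y.
  by apply/allpairsPdep; exists i, w; rewrite mem_enum.
- move=> _ /allpairsPdep[i [w [_ wL ->]]]; have [_ /(_ _ wL) h _] := LP i.
  by rewrite word_ratio_cons mulrC -ler_pdivlMr.
rewrite size_allpairs_dep sumnE big_map big_enum natr_sum/=.
apply: (@le_trans _ _ (\sum_i rho `^ (- d) * (r i `^ d * delta `^ (- d)))).
  apply: ler_sum => i _; have [_ _ h] := LP i; apply: (le_trans h).
  by have := powR_scale 0 d i d0; rewrite powRr0 mul1r add0r => ->.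
by rewrite -mulr_sumr -mulr_suml moran mul1r.
Qed.

(** Pigeonhole: with at most half as many cylinders as points, half of the points
  share a small cylinder with another point. *)
Lemma seq_energy_ge : exists2 c : R, 0 < c & forall xs, points_of A xs -> (1 < size xs)%N ->
  c * (size xs)%:R `^ (1 + s / d) <= seq_energy s xs.
Proof.
have [rho /andP[rho0 rho1] rhor] := min_ratio.
have [_ _ [_ cA] _ _] := SA; have [D D0 AD] := compact_ediam cA.
pose K := rho `^ (- d); have K0 : 0 < K by rewrite powR_gt0.
exists (2^-1 * D `^ (- s) * (2 * K) `^ (- (s / d))).
  by rewrite !mulr_gt0 ?powR_gt0 ?mulr_gt0// invr_gt0.
move=> xs [uxs xsA] xs1; set N := size xs in xs1 *.
have N0 : 0 < N%:R :> R by rewrite ltr0n (ltn_trans _ xs1).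
(* the scale at which the number of cylinders is at most [N / 2] *)
pose delta := (2 * K / N%:R) `^ d^-1.
have K20 : 0 < 2 * K by rewrite mulr_gt0.
have KN0 : 0 < 2 * K / N%:R by rewrite divr_gt0.
have d0 : 0 < delta by rewrite powR_gt0.
have deltaE a : delta `^ (- a) = (2 * K) `^ (- (a / d)) * N%:R `^ (a / d).
  rewrite /delta -powRrM (_ : d^-1 * - a = - (a / d)); last by ring.
  rewrite powRM ?invr_ge0 ?(ltW N0) ?(ltW K20)//; congr (_ * _).
  by rewrite -powR_inv1 ?(ltW N0)// -powRrM mulN1r opprK.
have [|L [cov Lr Ls]] := @stopping_words rho delta rho0 rhor.
  rewrite d0/=.
  have -> : rho^-1 = K `^ d^-1.
    by rewrite /K -powRrM mulNr mulfV ?gt_eqF// powR_inv1// ltW.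
  rewrite ge0_ler_powR ?nnegrE ?(ltW KN0) ?(ltW K0) ?invr_ge0 ?(ltW d_gt0)//.
  by rewrite ler_pdivrMr// mulrC ler_pM2l// ler_nat.
have {}Ls : (size L)%:R <= N%:R / 2 :> R.
  apply: (le_trans Ls); rewrite deltaE divff ?gt_eqF// powRr1 ?(ltW N0)//.
  rewrite powR_inv1 ?(ltW K20)// invfM -/K.
  by rewrite mulrA mulrCA mulfV ?gt_eqF// mulr1 mulrC.
pose col x := find (fun w => `[< cylinder f A w x >]) L.
have colP x : A x -> (col x < size L)%N /\ cylinder f A (nth [::] L (col x)) x.
  move=> /cov[w wL wx]; have hL : has (fun w => `[< cylinder f A w x >]) L.
    by apply/hasP; exists w => //; apply/asboolP.
  by split; [rewrite -has_find|exact/asboolP/(nth_find [::] hL)].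
have near x y : x \in xs -> y \in xs -> x != y -> col x = col y ->
    (D * delta) `^ (- s) <= riesz_kernel s x y.
  move=> xx yx xy cxy; apply: riesz_kernel_ge => //.
  have [cL [x' Ax' x'E]] := colP _ (xsA _ xx); have [_] := colP _ (xsA _ yx).
  rewrite -cxy => -[y' Ay' y'E]; rewrite -x'E -y'E (word_map_dilation SA) mulrC.
  apply: ler_pM; rewrite ?enorm_ge0 ?AD ?Lr ?mem_nth//.
  exact/ltW/(word_ratio_gt0 SA).
(* [col] is injective on these points, so there are at most [size L] of them *)
pose lonely x := all (fun y => (y == x) || (col y != col x)) xs.
have : (count lonely xs <= size L)%N.
  rewrite -size_filter -(size_map col) -[leqRHS](size_iota 0).
  apply: uniq_leq_size.
    rewrite map_inj_in_uniq ?filter_uniq// => x y.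
    rewrite !mem_filter => /andP[_ xx] /andP[/allP ly _] cxy.
    by have /orP[/eqP //|] := ly _ xx; rewrite cxy eqxx.
  move=> _ /mapP[x + ->]; rewrite mem_filter mem_iota/= add0n => /andP[_ xx].
  by have [] := colP _ (xsA _ xx).
rewrite -(ler_nat R) => lonL.
apply: (@le_trans _ _ (\sum_(x <- xs | ~~ lonely x) (D * delta) `^ (- s))).
  rewrite big_const_seq iter_addr addr0 -[leRHS]mulr_natl.
  have -> : (count (fun x => ~~ lonely x) xs)%:R = N%:R - (count lonely xs)%:R :> R.
    by rewrite /N -(count_predC lonely xs) natrD addrAC subrr add0r.
  rewrite [(D * delta) `^ _]powRM ?(ltW D0) ?(ltW d0)// deltaE.
  rewrite powRD; last by rewrite (gt_eqF N0) implybT.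
  rewrite powRr1 ?(ltW N0)//.
  rewrite (_ : _ * _ * _ * (_ * _) = N%:R / 2 * (D `^ (- s) * ((2 * K) `^ (- (s / d)) * N%:R `^ (s / d)))); last by ring.
  rewrite ler_wpM2r//; first by rewrite !mulr_ge0 ?powR_ge0.
  by move: lonL Ls; lra.
rewrite /seq_energy big_mkcond big_seq [leRHS]big_seq; apply: ler_sum => x xx.
case: ifP => [/allPn[y yx]|_]; last by apply: sumr_ge0 => y _; exact: powR_ge0.
rewrite negb_or negbK => /andP[yx' /eqP cyx].
rewrite (bigD1_seq y)//=; apply: ler_wpDr; first by apply: sumr_ge0 => z _; exact: powR_ge0.
by apply: near => //; rewrite eq_sym.
Qed.

End energy_bounds.

Section energy_upper_bound.
Context {R : realType} {p : nat} {I : finType}.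
Context (r : I -> R) (f : I -> 'rV[R]_p -> 'rV[R]_p) (A : set 'rV[R]_p).
Context (SA : separated_ifs r f A).
Context (s d : R).
Context (d_gt0 : 0 < d).
Context (d_lt_s : d < s).
Context (moran : \sum_i r i `^ d = 1).

Let s_gt0 : 0 < s. Proof. exact: lt_trans d_lt_s. Qed.
Let r_gt0 i : 0 < r i. Proof. by case: SA => /(_ i)/andP[]. Qed.

(** Transport [xs i] to the [i]-th piece. Points of different pieces are at
  distance at least [e], which bounds each of their interactions. *)
Lemma glue_points (e : R) (xs : I -> seq 'rV[R]_p) : 0 < e ->
  (forall i j x y, i != j -> A x -> A y -> e <= enorm (f i x - f j y)) ->
  (forall i, points_of A (xs i)) ->
  exists ys, [/\ points_of A ys, size ys = \sum_i size (xs i) &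
    seq_energy s ys <= \sum_i r i `^ (- s) * seq_energy s (xs i) +
      e `^ (- s) * (size ys)%:R ^+ 2].
Proof.
move=> e0 sepA xsA; pose ys := [seq f i x | i <- enum I, x <- xs i].
have szE : size ys = \sum_i size (xs i).
  by rewrite size_allpairs_dep sumnE big_map big_enum.
exists ys; split => //.
  split=> [|_ /allpairsPdep[i [x [_ xi ->]]]].
    apply: (@allpairs_uniq_dep I (fun=> 'rV[R]_p : eqType)).
    - exact: enum_uniq.
    - by move=> i _; case: (xsA i).
    have st_mem (q : {i : I & 'rV[R]_p}) :
        q \in [seq existT (fun=> 'rV[R]_p : Type) x y | x <- enum I, y <- xs x] -> A (tagged q).
      by move=> /allpairsPdep[i [x [_ xi ->]]]; exact: (xsA i).2.
    move=> p1 p2 p1A p2A; have := st_mem _ p2A; have := st_mem _ p1A.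
    case: p1 p2 {p1A p2A} => [i x] [j y] /= Ax Ay fxy.
    have ij := ifs_eq SA Ax Ay fxy; rewrite -ij in fxy *.
    by rewrite (ifs_inj SA fxy).
  by apply: ifs_sub SA _ _ _; exact: (xsA i).2.
rewrite {1}/seq_energy /ys big_allpairs_dep big_enum/=.
have le1 i x : x \in xs i -> \sum_(y <- ys) riesz_kernel s (f i x) y <=
    r i `^ (- s) * (\sum_(y <- xs i) riesz_kernel s x y) + e `^ (- s) * (size ys)%:R.
  move=> xi; rewrite /ys big_allpairs_dep big_enum/= (bigD1 i)//=; apply: lerD.
    rewrite mulr_sumr; apply: ler_sum => y _.
    have fi : dilation (r i) (f i) by case: SA.
    by rewrite /riesz_kernel fi powRM// ?enorm_ge0// ltW.
  apply: (@le_trans _ _ (\sum_(j | j != i) e `^ (- s) * (size (xs j))%:R)).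
    apply: ler_sum => j ji.
    rewrite -sum1_size natr_sum mulr_sumr big_seq [leRHS]big_seq.
    apply: ler_sum => y yj; rewrite mulr1; apply: riesz_kernel_le => //.
    by apply: sepA; rewrite 1?eq_sym//; [exact: (xsA i).2|exact: (xsA j).2].
  rewrite -mulr_sumr ler_wpM2l ?powR_ge0// szE natr_sum [leRHS](bigD1 i)//=.
  by rewrite lerDr.
apply: (@le_trans _ _ (\sum_i \sum_(x <- xs i) (r i `^ (- s) *
   (\sum_(y <- xs i) riesz_kernel s x y) + e `^ (- s) * (size ys)%:R))).
  apply: ler_sum => i _; rewrite big_seq [leRHS]big_seq.
  by apply: ler_sum => x xi; exact: le1.
rewrite -/ys (eq_bigr (fun i => r i `^ (- s) * seq_energy s (xs i) +
    e `^ (- s) * (size ys)%:R * (size (xs i))%:R)) => [|i _]; last first.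
  rewrite big_split/= -mulr_sumr big_const_seq iter_addr addr0 count_predT.
  by rewrite [in RHS]mulr_natr.
by rewrite big_split/= lerD2l -mulr_sumr -natr_sum -szE -mulrA.
Qed.

(** The negative term [- c' * delta `^ (- (2 * d))] makes the induction on
  scales close: since [2 * d - s < d], gluing multiplies it by the factor
  [\sum_i r i `^ (2 * d - s)], which is larger than one, and the surplus absorbs
  the interactions between the pieces. *)
Lemma points_at_scale (rho : R) : 0 < rho -> (forall i, rho <= r i) ->
  exists c c' : R, 0 <= c' /\ forall delta, 0 < delta <= rho^-1 ->
  exists xs, [/\ points_of A xs, delta `^ (- d) <= (size xs)%:R,
    (size xs)%:R <= rho `^ (- d) * delta `^ (- d) &
    seq_energy s xs <= c * delta `^ (- (s + d)) - c' * delta `^ (- (2 * d))].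
Proof.
move=> rho0 rhor; have [e e0 sepA] := ifs_separation SA.
pose theta := \sum_i r i `^ (2 * d - s); pose K := rho `^ (- d).
have theta1 : 1 < theta.
  by rewrite -moran; apply: (sum_powR_decr SA); rewrite ltrBlDr; move: d_lt_s; lra.
(* the surplus [c' * (theta - 1)] equals the bound on the interactions *)
pose c' := e `^ (- s) * K ^+ 2 / (theta - 1).
have c'0 : 0 <= c'.
  by rewrite divr_ge0 ?mulr_ge0 ?powR_ge0 ?exprn_ge0 ?powR_ge0// subr_ge0 ltW.
(* this [c] makes the bound nonnegative at the scales of one-point lists *)
exists (c' * rho `^ (- (s - d))), c'; split => // delta; move: delta.
apply: (scale_ind SA rho0 rhor) => delta.
  move=> /andP[d1 drho]; have d0 := lt_le_trans ltr01 d1.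
  have [_ _ [[x0 Ax0] _] _ _] := SA; exists [:: x0].
  have rd1 : rho * delta <= 1 by rewrite mulrC -ler_pdivlMr// mul1r.
  have pow1 (u a : R) : 0 < u <= 1 -> 0 <= a -> 1 <= u `^ (- a).
    move=> /andP[u0 u1] a0; rewrite powRN invf_ge1 ?powR_gt0//.
    by rewrite -[leRHS](congr1 (@^~ a) (@powR1 R)) ge0_ler_powR ?nnegrE ?(ltW u0).
  split.
  - by split=> // x; rewrite inE => /eqP ->.
  - rewrite powRN invf_le1 ?powR_gt0//.
    by rewrite -[leLHS](congr1 (@^~ d) (@powR1 R)) ge0_ler_powR ?nnegrE ?(ltW d0) ?(ltW d_gt0).
  - by rewrite -powRM ?(ltW d0) ?(ltW rho0)// pow1 ?mulr_gt0 ?rd1 ?(ltW d_gt0).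
  rewrite /seq_energy !big_seq1 /riesz_kernel subrr enorm0 powR0; last first.
    by rewrite oppr_eq0 gt_eqF.
  rewrite -mulrA -mulrBr mulr_ge0// subr_ge0.
  rewrite (_ : - (s + d) = - (s - d) + - (2 * d)); last by ring.
  rewrite powRD; last by rewrite (gt_eqF d0) implybT.
  rewrite mulrA ler_peMl ?powR_ge0// -powRM ?(ltW d0) ?(ltW rho0)// pow1 ?mulr_gt0 ?rd1//.
  by rewrite subr_ge0 ltW.
move=> /andP[d0 d1] /choice[xs xsP].
have [|ys [ysA ysE ysen]] := glue_points e0 sepA (xs := xs).
  by move=> i; have [] := xsP i.
have shrink i : (delta / r i) `^ (- d) = r i `^ d * delta `^ (- d).
  by have := powR_scale SA 0 d i d0; rewrite powRr0 mul1r add0r.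
have size_lo : delta `^ (- d) <= (size ys)%:R.
  rewrite ysE natr_sum -[leLHS]mul1r -[X in X * _ <= _]moran mulr_suml; apply: ler_sum => i _.
  by have [_ + _ _] := xsP i; rewrite shrink.
have size_hi : (size ys)%:R <= K * delta `^ (- d).
  rewrite ysE natr_sum -[X in K * X]mul1r -[X in _ <= K * (X * _)]moran mulr_suml mulr_sumr; apply: ler_sum => i _.
  by have [_ _ + _] := xsP i; rewrite shrink.
exists ys; split => //; apply: (le_trans ysen).
have size2 : (size ys)%:R ^+ 2 <= K ^+ 2 * delta `^ (- (2 * d)).
  have -> : K ^+ 2 * delta `^ (- (2 * d)) = (K * delta `^ (- d)) ^+ 2.
    rewrite exprMn; congr (_ * _); rewrite -(powR_mulrn 2 (powR_ge0 _ _)) -powRrM.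
    by congr (_ `^ _); ring.
  by rewrite lerXn2r ?nnegrE ?ler0n ?mulr_ge0 ?powR_ge0//.
set c := c' * _.
have sum_le : \sum_i r i `^ (- s) * seq_energy s (xs i) <=
    c * delta `^ (- (s + d)) - c' * theta * delta `^ (- (2 * d)).
  apply: (@le_trans _ _ (\sum_i (r i `^ d * (c * delta `^ (- (s + d))) -
     r i `^ (2 * d - s) * (c' * delta `^ (- (2 * d)))))).
    apply: ler_sum => i _; have [_ _ _ h] := xsP i.
    apply: (le_trans (ler_wpM2l (powR_ge0 _ _) h)).
    rewrite mulrBr ![r i `^ (- s) * (_ * _)]mulrCA !(powR_scale SA)//.
    rewrite (_ : - s + (s + d) = d); last by ring.
    rewrite (_ : - s + 2 * d = 2 * d - s); last by ring.
    by rewrite lerB//; rewrite mulrCA.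
  rewrite sumrB -!mulr_suml moran mul1r -/theta.
  by rewrite mulrA [theta * c']mulrC.
have : e `^ (- s) * (size ys)%:R ^+ 2 <= c' * (theta - 1) * delta `^ (- (2 * d)).
  rewrite /c' divfK; last by rewrite subr_eq0 gt_eqF.
  by rewrite -mulrA ler_wpM2l ?powR_ge0.
move: sum_le; rewrite mulrBr mulr1 mulrBl; lra.
Qed.

(** The scale [n `^ (- d^-1)] yields at least [n] points. *)
Lemma seq_energy_le : exists C : R, forall n0, exists xs,
  [/\ points_of A xs, (n0 <= size xs)%N & seq_energy s xs <= C * (size xs)%:R `^ (1 + s / d)].
Proof.
have [rho /andP[rho0 rho1] rhor] := min_ratio SA.
have [c [c' [c'0 cP]]] := points_at_scale rho0 rhor.
exists (Num.max c 0) => n0.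
pose n := n0.+1; pose delta := (n%:R : R) `^ (- d^-1).
have nR0 : 0 < n%:R :> R by rewrite ltr0n.
have d0 : 0 < delta by rewrite powR_gt0.
have [|xs [xsA size_lo size_hi en]] := cP delta.
  rewrite d0/= (@le_trans _ _ 1)//; last by rewrite invf_ge1// ltW.
  rewrite /delta powRN invf_le1 ?powR_gt0//.
  rewrite -[leLHS](congr1 (@^~ d^-1) (@powR1 R)) ge0_ler_powR ?nnegrE ?invr_ge0 ?(ltW d_gt0) ?(ltW nR0)//.
  by rewrite ler1n.
have deltaE : delta `^ (- d) = n%:R.
  by rewrite /delta -powRrM mulrNN mulVf ?gt_eqF// powRr1// ltW.
exists xs; split => //.
  by rewrite deltaE ler_nat in size_lo; exact: leq_trans size_lo.
apply: (le_trans en); apply: (@le_trans _ _ (Num.max c 0 * delta `^ (- (s + d)))).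
  rewrite lerBlDr ler_wpDr ?mulr_ge0 ?powR_ge0//.
  by rewrite ler_wpM2r ?powR_ge0// le_max lexx.
rewrite ler_wpM2l ?le_max ?lexx ?orbT//.
rewrite (_ : - (s + d) = - d * (1 + s / d)); last by field; rewrite gt_eqF.
rewrite powRrM ge0_ler_powR ?nnegrE ?powR_ge0//.
by rewrite addr_ge0// divr_ge0 ?(ltW d_gt0) ?(ltW s_gt0).
Qed.

End energy_upper_bound.

(** * A quantitative form of strict convexity *)

Section convexity.
Context {R : realType}.

(** Bernoulli's inequality is Young's inequality for the product [b * 1]. *)
Lemma powR_bernoulli (b q : R) : 0 <= b -> 1 < q -> 1 + q * (b - 1) <= b `^ q.
Proof.
move=> b0 q1; have q0 : 0 < q by lra.
have qN0 : q != 0 by rewrite gt_eqF.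
have q1N0 : q - 1 != 0 by rewrite gt_eqF// subr_gt0.
have h := @conjugate_powR R b 1 q (q / (q - 1)) b0 ler01 q0.
have : b * 1 <= b `^ q / q + 1 `^ (q / (q - 1)) / (q / (q - 1)).
  apply: h; first by rewrite divr_gt0// subr_gt0.
  by field; rewrite qN0 q1N0.
rewrite powR1 mulr1 => h1; have := ler_wpM2l (ltW q0) h1.
rewrite (_ : q * (_ + _) = b `^ q + (q - 1)); first by lra.
by field; rewrite qN0 q1N0.
Qed.

(** Bernoulli's inequality for [b ^+ 2] and the exponent [q / 2]. *)
Lemma powR_ge_quadratic (b q : R) : 0 <= b -> 2 < q ->
  1 + q * (b - 1) + q / 2 * (b - 1) ^+ 2 <= b `^ q.
Proof.
move=> b0 q2; have -> : b `^ q = (b ^+ 2) `^ (q / 2).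
  by rewrite -(powR_mulrn 2 b0) -powRrM; congr (_ `^ _); field.
apply: le_trans (powR_bernoulli _ _); [|exact: exprn_ge0|lra].
by rewrite le_eqVlt; apply/orP; left; apply/eqP; field.
Qed.

(** For [alpha = c `^ d * b] this is [powR_ge_quadratic], multiplied by [c `^ d].
  The affine terms on the left are the tangent of the right-hand side at
  [c `^ d]; in a sum over cylinders they add up to one. *)
Lemma block_weight_ge (c d s alpha : R) : 0 < c <= 1 -> 0 < d -> d < s -> 0 <= alpha ->
  c `^ d + (1 + s / d) * (alpha - c `^ d) + (alpha - c `^ d) ^+ 2 <=
  c `^ (- s) * alpha `^ (1 + s / d).
Proof.
move=> /andP[c0 c1] d0 ds a0; set q := 1 + s / d; set u := c `^ d.
have u0 : 0 < u by rewrite powR_gt0.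
have u1 : u <= 1.
  by rewrite -[leRHS](congr1 (@^~ d) (@powR1 R)) ge0_ler_powR ?nnegrE ?(ltW c0) ?(ltW d0).
have q2 : 2 < q.
  rewrite /q (_ : 2 = 1 + 1 :> R)// ltrD2l.
  by rewrite ltr_pdivlMr// mul1r.
pose b := alpha / u; have b0 : 0 <= b by rewrite divr_ge0// ltW.
have alphaE : alpha = u * b by rewrite /b mulrC divfK// gt_eqF.
have -> : c `^ (- s) * alpha `^ q = u * b `^ q.
  rewrite alphaE powRM ?(ltW u0)// mulrA; congr (_ * _).
  rewrite /u -powRrM -powRD; last by rewrite (gt_eqF c0) implybT.
  by congr (_ `^ _); rewrite /q; field; rewrite gt_eqF.
apply: le_trans (ler_wpM2l (ltW u0) (powR_ge_quadratic b0 q2)).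
rewrite alphaE (_ : u * b - u = u * (b - 1)); last by ring.
have h : (u * (b - 1)) ^+ 2 <= u * (q / 2 * (b - 1) ^+ 2).
  rewrite exprMn expr2 -mulrA ler_wpM2l ?(ltW u0)// ler_wpM2r ?sqr_ge0//; lra.
by move: h; rewrite !mulrDr; lra.
Qed.

End convexity.

(** * Equidistribution among cylinders *)

Section equidistribution.
Context {R : realType} {p : nat} {I : finType}.
Context (r : I -> R) (f : I -> 'rV[R]_p -> 'rV[R]_p) (A : set 'rV[R]_p).
Context (SA : separated_ifs r f A).
Context (s d : R).
Context (d_gt0 : 0 < d).
Context (d_lt_s : d < s).
Context (moran : \sum_i r i `^ d = 1).

Local Notation cyl := (cylinder f A).
Local Notation a := (1 + s / d).

Let s_gt0 : 0 < s. Proof. exact: lt_trans d_lt_s. Qed.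

Let a_gt1 : 1 < a. Proof. by rewrite ltrDl divr_gt0. Qed.

Lemma word_ratio_le1 w : word_ratio r w <= 1.
Proof.
have [c /andP[c0 c1] rc] := max_ratio SA; apply: (le_trans (word_ratio_expr SA w rc)).
by rewrite exprn_ile1// ltW.
Qed.

Lemma cylinder_pullback w xs : points_of A xs ->
  exists ys, [/\ points_of A ys, size ys = count (mem (cyl w)) xs &
    seq_energy s [seq x <- xs | x \in cyl w] = word_ratio r w `^ (- s) * seq_energy s ys].
Proof.
move=> [uxs xsA].
have [ys [ysA ysE]] : exists ys, (forall y, y \in ys -> A y) /\
    map (word_map f w) ys = [seq x <- xs | x \in cyl w].
  elim: xs {uxs xsA} => [|x xs [ys [ysA ysE]]]; first by exists [::].
  rewrite /=; case: ifPn => [|_]; last by exists ys.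
  rewrite inE => -[y Ay yx]; exists (y :: ys) => /=; rewrite yx ysE; split => // z.
  by rewrite inE => /predU1P[-> //|/ysA].
exists ys; split.
- split => //; apply: (@map_uniq _ _ (word_map f w)).
  by rewrite ysE filter_uniq.
- by rewrite -(size_map (word_map f w)) ysE size_filter.
- by rewrite -ysE (seq_energy_map _ _ (word_ratio_gt0 SA w) (word_map_dilation SA w)).
Qed.

Lemma sum_count_words n xs : (forall x, x \in xs -> A x) ->
  \sum_(w <- words n) count (mem (cyl w)) xs = size xs.
Proof.
move=> xsA; under eq_bigr do rewrite -sum1_count big_mkcond.
rewrite exchange_big/= -sum1_size; apply: eq_big_seq => x /xsA Ax.
have [w wn wx] := words_cover SA n Ax.
have wW : w \in words n by rewrite mem_words wn.
rewrite (bigD1_seq w)//=; last exact: uniq_words.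
rewrite mem_set// big_seq_cond big1// => u /andP[un uw].
case: ifPn => //; rewrite inE => -[y Ay yx]; case: wx => z Az zx.
move: uw; rewrite (_ : u = w) ?eqxx//.
apply: (word_map_eq SA _ Ay Az); last by rewrite yx zx.
by rewrite wn; apply/eqP; rewrite -mem_words.
Qed.

(** The quantitative form of the convexity argument. Energy at least
  [g * n `^ a] for large configurations forces, through self-similarity and
  the omission of interactions between cylinders, an excess of energy as soon as
  the proportion of points in some cylinder departs from its mass. *)
Lemma seq_energy_excess (g : R) n0 w : 0 < g ->
  (forall xs, points_of A xs -> (n0 <= size xs)%N ->
     g * (size xs)%:R `^ a <= seq_energy s xs) ->
  exists C : R, forall xs, points_of A xs -> (0 < size xs)%N ->
    g * (1 + ((count (mem (cyl w)) xs)%:R / (size xs)%:R - word_ratio r w `^ d) ^+ 2)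
      - C / (size xs)%:R `^ a <= seq_energy s xs / (size xs)%:R `^ a.
Proof.
move=> g0 gP; set k := size w.
(* this constant makes up for the cylinders with fewer than [n0] points *)
exists (\sum_(u <- words k) word_ratio r u `^ (- s) * (g * n0%:R `^ a)) => xs xsA N0.
set N := size xs in N0 *; have NR0 : 0 < N%:R :> R by rewrite ltr0n.
have a0 : 0 <= a by rewrite ltW// (lt_trans ltr01).
pose cnt u := count (mem (cyl u)) xs; pose alpha u : R := (cnt u)%:R / N%:R.
have alpha0 u : 0 <= alpha u by rewrite divr_ge0.
have Na0 : 0 < N%:R `^ a by rewrite powR_gt0.
rewrite lerBlDr -mulrDl ler_pdivlMr//.
have blocks : \sum_(u <- words k) word_ratio r u `^ (- s) * (g * (cnt u)%:R `^ a - g * n0%:R `^ a)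
    <= seq_energy s xs.
  apply: le_trans (@seq_energy_blocks _ _ s _ (words k) (fun u => mem (cyl u)) xs (uniq_words _) _).
    apply: ler_sum => u _; have [ys [ysA ysn ->]] := cylinder_pullback u xsA.
    rewrite ler_wpM2l ?powR_ge0// -/(cnt u) /cnt -ysn.
    have [n0ys|ysn0] := leqP n0 (size ys).
      by apply: le_trans (gP _ ysA n0ys); rewrite gerBl mulr_ge0 ?powR_ge0// ltW.
    apply: le_trans (seq_energy_ge0 _ _); rewrite subr_le0 ler_wpM2l ?(ltW g0)//.
    by rewrite ge0_ler_powR ?nnegrE// ler_nat ltnW.
  move=> u v x; rewrite !mem_words => /eqP un /eqP vn /=; rewrite !inE => -[y Ay yx] [z Az zx].
  by apply: (word_map_eq SA _ Ay Az); rewrite ?un ?vn// yx zx.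
have sum1 : \sum_(u <- words k) alpha u = 1.
  rewrite -mulr_suml -natr_sum sum_count_words ?divff ?gt_eqF//.
  exact: xsA.2.
have convex : 1 + (alpha w - word_ratio r w `^ d) ^+ 2 <=
    \sum_(u <- words k) word_ratio r u `^ (- s) * alpha u `^ a.
  apply: (@le_trans _ _ (\sum_(u <- words k) (word_ratio r u `^ d + a * (alpha u - word_ratio r u `^ d)
     + (alpha u - word_ratio r u `^ d) ^+ 2))); last first.
    apply: ler_sum => u _; apply: block_weight_ge => //.
    by rewrite (word_ratio_gt0 SA) word_ratio_le1.
  rewrite !big_split/= -mulr_sumr sumrB sum1 (sum_words SA) moran expr1n subrr mulr0 addr0.
  rewrite lerD2l (bigD1_seq w) ?mem_words ?uniq_words//= lerDl.
  by apply: sumr_ge0 => u _; exact: sqr_ge0.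
have alphaE u : (cnt u)%:R `^ a = alpha u `^ a * N%:R `^ a.
  by rewrite -powRM// ?alpha0// /alpha divfK// gt_eqF.
apply: le_trans (lerD blocks (lexx _)).
rewrite -big_split/=.
apply: (@le_trans _ _ (g * (\sum_(u <- words k) word_ratio r u `^ (- s) * alpha u `^ a) * N%:R `^ a)).
  by rewrite ler_pM2r// ler_pM2l.
rewrite mulr_sumr mulr_suml; apply: ler_sum => u _.
by rewrite alphaE le_eqVlt; apply/orP; left; apply/eqP; ring.
Qed.

Lemma min_energy_points N xs : points_of A xs -> size xs = N ->
  (min_energy s A N <= (seq_energy s xs)%:E)%E.
Proof.
move=> xsA <-; apply: ereal_inf_lbound.
exists (fun i : 'I_(size xs) => nth 0 xs i); first exact: points_configuration.
by rewrite riesz_energy_nth.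
Qed.

Lemma le_min_energy N (e : R) :
  (forall xs, points_of A xs -> size xs = N -> e <= seq_energy s xs) ->
  (e%:E <= min_energy s A N)%E.
Proof.
move=> h; apply: le_ereal_inf_tmp => _ [x cx <-].
rewrite lee_fin riesz_energyE//; apply: h; first exact: configuration_points.
by rewrite size_map size_enum_ord.
Qed.

(** The two energy bounds make the lower limit a positive real number, by which
  one can divide. *)
Lemma lower_gP : exists g : R, [/\ 0 < g, lower_g s d A = g%:E &
  forall eta, 0 < eta -> exists n0, forall xs, points_of A xs -> (n0 <= size xs)%N ->
     (g - eta) * (size xs)%:R `^ a <= seq_energy s xs].
Proof.
pose u N := (min_energy s A N / (N%:R `^ a)%:E)%E.
have uge N (e : R) : (0 < N)%N -> (e%:E <= u N)%E = ((e * N%:R `^ a)%:E <= min_energy s A N)%E.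
  move=> N0; have Na : 0 < N%:R `^ a :> R by rewrite powR_gt0// ltr0n.
  by rewrite /u inver gt_eqF// lee_pdivlMr// EFinM.
have ule N (e : R) : (0 < N)%N -> (min_energy s A N <= (e * N%:R `^ a)%:E)%E -> (u N <= e%:E)%E.
  move=> N0; have Na : 0 < N%:R `^ a :> R by rewrite powR_gt0// ltr0n.
  by rewrite /u inver gt_eqF// lee_pdivrMr// EFinM.
have gE : lower_g s d A = ereal_sup (range (einfs u)).
  rewrite /lower_g limn_einf_lim; apply/cvg_lim => //.
  exact/ereal_nondecreasing_cvgn/nondecreasing_einfs.
have [c c0 cP] := seq_energy_ge SA d_gt0 d_lt_s moran.
have [C CP] := seq_energy_le SA d_gt0 d_lt_s moran.
have gc : (c%:E <= lower_g s d A)%E.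
  rewrite gE; apply: (@le_trans _ _ (einfs u 2)); last by apply: ereal_sup_ubound; exists 2%N.
  apply: le_ereal_inf_tmp => _ [N /= N2 <-]; rewrite uge ?(ltn_trans _ N2)//.
  by apply: le_min_energy => xs xsA xsN; rewrite -xsN; apply: cP => //; rewrite xsN.
have gC : (lower_g s d A <= C%:E)%E.
  rewrite gE; apply: ge_ereal_sup => _ [n _ <-].
  have [xs [xsA nxs xsC]] := CP n.+1.
  apply: (@le_trans _ _ (u (size xs))).
    by apply: ereal_inf_lbound; exists (size xs) => //=; exact: ltnW.
  apply: ule; first exact: leq_trans nxs.
  by apply: (le_trans (min_energy_points xsA erefl)); rewrite lee_fin.
have gf : lower_g s d A \is a fin_num.
  by rewrite fin_numElt (lt_le_trans _ gc) ?ltNyr// (le_lt_trans gC) ?ltry.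
exists (fine (lower_g s d A)); split.
- by rewrite fine_gt0// (lt_le_trans _ gc) ?lte_fin//= (le_lt_trans gC) ?ltry.
- by rewrite fineK.
move=> eta eta0.
have : ((fine (lower_g s d A) - eta)%:E < ereal_sup (range (einfs u)))%E.
  by rewrite -gE EFinB fineK// lteBlDr// lteDl.
move=> /ereal_sup_gt[_ [n _ <-] ltn_]; exists n.+1 => xs xsA nxs.
have xs0 : (0 < size xs)%N by exact: leq_trans nxs.
rewrite -lee_fin; apply: le_trans (min_energy_points xsA erefl).
rewrite -uge//; apply: (le_trans (ltW ltn_)); apply: ereal_inf_lbound.
by exists (size xs) => //=; exact: ltnW.
Qed.

Lemma equidistribution (NN : set nat) (x : forall N : nat, 'I_N -> 'rV[R]_p) :
  (forall N, NN N -> configuration A (x N)) ->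
  (riesz_energy s (x N) / N%:R `^ a)%:E @[N --> within NN \oo] --> lower_g s d A ->
  forall w, N%:R^-1 * \sum_(i < N) (x N i \in cyl w)%:R @[N --> within NN \oo] -->
    word_ratio r w `^ d.
Proof.
move=> cx + w; have [g [g0 -> gP]] := lower_gP.
move=> /fine_cvgP[_ /= cvgg]; apply/cvgrPdist_le => e e0.
(* so that [(g - eta) * t ^+ 2 <= 3 * eta] implies [t ^+ 2 <= e ^+ 2] *)
pose eta := Num.min (g / 2) (g * e ^+ 2 / 6).
have eta0 : 0 < eta by rewrite lt_min !divr_gt0 ?mulr_gt0 ?exprn_gt0.
have etag : eta <= g / 2 by rewrite ge_min lexx.
have etae : eta <= g * e ^+ 2 / 6 by rewrite ge_min lexx orbT.
have [n0 n0P] := gP _ eta0.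
have ge0 : 0 < g - eta by move: g0 etag; lra.
have [C CP] := seq_energy_excess w ge0 n0P.
move/cvgrPdist_le/(_ _ eta0) : cvgg => h.
have hN : \forall N \near within NN \oo, NN N by exact: withinT.
have hC : \forall N \near within NN \oo, (0 < N)%N /\ C / eta <= N%:R.
  apply: cvg_within; near=> N; split; first by near: N; exact: nbhs_infty_gt.
  by near: N; exact: nbhs_infty_ger.
apply: filterS3 hN hC h => N NNN [N0 CN] h.
pose xs := [seq x N i | i <- enum 'I_N].
have sz : size xs = N by rewrite size_map size_enum_ord.
have xsA : points_of A xs := configuration_points (cx _ NNN).
have := CP _ xsA; rewrite sz => /(_ N0).
have -> : (count (mem (cyl w)) xs)%:R / N%:R = N%:R^-1 * \sum_(i < N) (x N i \in cyl w)%:R :> R.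
  rewrite mulrC; congr (_ * _).
  by rewrite /xs count_map -sum1_count big_enum_cond/= natr_sum big_mkcond/=; apply: eq_bigr => i _; case: ifP.
rewrite -riesz_energyE//; set beta := _ * \sum_(i < N) _; set q := _ `^ d.
have Na0 : 0 < N%:R `^ a :> R by rewrite powR_gt0// ltr0n.
have CNa : C / N%:R `^ a <= eta.
  rewrite ler_pdivrMr// mulrC -ler_pdivrMr// (le_trans CN)//.
  by apply: le1r_powR; rewrite ?ler1n// ltW.
move: h; rewrite ler_distlC => /andP[_ h] h1.
have h2 : (beta - q) ^+ 2 <= e ^+ 2.
  have : (g - eta) * (beta - q) ^+ 2 <= 3 * eta by move: h h1 CNa; rewrite mulrDr mulr1 /=; lra.
  have : g / 2 * (beta - q) ^+ 2 <= (g - eta) * (beta - q) ^+ 2.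
    by rewrite ler_wpM2r ?sqr_ge0//; lra.
  move=> h3 h4; have : g / 2 * (beta - q) ^+ 2 <= g / 2 * e ^+ 2 by lra.
  by rewrite ler_pM2l// divr_gt0.
by rewrite distrC -(ler_sqr (normr_ge0 _) (ltW e0))?nnegrE// real_normK ?num_real.
Unshelve. all: by end_near. Qed.

End equidistribution.

Lemma self_similar_separated_ifs (R : realType) (p M : nat) (r : 'I_M -> R)
    (psi : 'I_M -> 'rV[R]_p -> 'rV[R]_p) (A : set 'rV[R]_p) :
  self_similar_fractal r psi A -> separated_ifs r psi A.
Proof.
move=> [_ sim A0 AE /trivIsetP tA]; split => // [i|i|i j x y Ax Ay fxy].
- by have [] := sim i.
- exact: similitude_dilation.
apply/eqP; apply: contrapT => /negP ij.
have /seteqP[/(_ (psi i x)) + _] := tA i j I I ij.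
by apply; split; [exists x|exists y].
Qed.

Theorem theorem4p1 (R : realType) (p M : nat) (r : 'I_M -> R)
    (psi : 'I_M -> 'rV[R]_p -> 'rV[R]_p) (A : set 'rV[R]_p) (d s : R)
    (NN : set nat) (x : forall N : nat, 'I_N -> 'rV[R]_p) :
  self_similar_fractal r psi A ->
  open_set_condition psi ->
  hausdorff_dim A = d%:E ->
  d < s ->
  infinite_set NN ->
  (forall N, NN N -> configuration A (x N)) ->
  (riesz_energy s (x N) / N%:R `^ (1 + s / d))%:E @[N --> within NN \oo]
    --> lower_g s d A ->
  weak_star_cvg A (within NN \oo) (fun N => empirical_measure (x N))
    (normalized_hausdorff d A).
Proof.
move=> ssf _ dimA ds _ cx energy_cvg.
have SA := self_similar_separated_ifs ssf.
have [d0 moran] : 0 < d /\ \sum_i r i `^ d = 1.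
  by apply: (hausdorff_dim_ifs SA) => //; rewrite card_ord; case: ssf.
have [kappa kappa0 kappaP] := hausdorff_content_ifs_gt0 SA d0 moran.
apply: (weak_star_cvg_cylinders SA _ (ltW d0)) => //.
  rewrite (hausdorff_measure_ifs_lty SA (ltW d0) moran) andbT.
  apply: lt_le_trans (hausdorff_content_le d A ltr01).
  by apply: lt_le_trans (kappaP 1); rewrite lte_fin.
exact: (equidistribution SA d0 ds moran cx energy_cvg).
Qed.
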